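(* In the algorithm setup, assume Property (P1). Then, with $n=|V|$ and $\alpha=d/r$ (so $|E|=\alpha n$), $$\frac{1}{\alpha n}\sum_{a\in E}\mathbb E\big[f(\mathbf z^L_{\partial a})\big]=\hat f(\emptyset)+\frac{r}{\sqrt d}\sum_{\ell=0}^{L-1}\Big(\frac1n\sum_{i\in V}\mathbb E\big[A_i^\ell\,(u_i^{\ell+1})^2\big]\Big)+O_d\Big(\frac1d\Big).$$
   Context: Algorithm setup. Fix $r\ge2$ and a predicate $f:\{\pm1\}^r\to\{0,1\}$, identified with its multilinear extension $f(x)=\sum_{S\subseteq[r]}\hat f(S)\prod_{\iota\in S}x_\iota$ on $\mathbb R^r$, and assume $\hat f(S)=0$ whenever $|S|=1$. Let $\xi(s)=\sum_{j=1}^r\big(\sum_{|S|=j}\hat f(S)^2\big)s^j$. Fix $\delta>0$, let $L=\lfloor1/\delta\rfloor$, and for $\ell\ge1$ let $\nu_\ell=\big(\xi'(\ell\delta)-\xi'((\ell-1)\delta)\big)/r$. Let $G=(V,E)$ be a hypergraph whose hyperedges (factors) $a$ are ordered $r$-tuples $\partial a=(v_{a,1},\dots,v_{a,r})$ of distinct vertices (variables), which is $d$-index-regular: every variable lies in exactly $d$ factors, and for each $\iota\in[r]$ it is the $\iota$-th entry of exactly $d/r$ factors. Write $\partial i$ for the set of factors containing $i$. Assume the bipartite variable–factor incidence graph (factor graph) of $G$ has no cycle of length less than $4L+4$. For a factor $a$ and $j\in\partial a$, $\mathsf D_{j;a}f$ is the partial derivative of (multilinear) $f$ in the coordinate $\iota$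 with $v_{a,\iota}=j$ (it does not depend on that coordinate). Fix $K>0$ and functions $F_{\to,\ell},F_\ell:\mathbb R^\ell\to[-K,K]$ for $0\le\ell\le L-1$ (constants when $\ell=0$). Randomness: $z_i^0$, $i\in V$, i.i.d. $\mathcal N(0,\delta)$; set $z^0_{i\to a}=z_i^0$, $w_i^0=w^0_{i\to a}=0$. For $\ell=0,\dots,L-1$: $A^\ell_{i\to a}=F_{\to,\ell}(u^1_{i\to a},\dots,u^\ell_{i\to a})$, $A^\ell_i=F_\ell(u^1_i,\dots,u^\ell_i)$; with $\mathbf z^\ell_{\partial b\to b}=(z^\ell_{v_{b,1}\to b},\dots,z^\ell_{v_{b,r}\to b})$, $w^{\ell+1}_{i\to a}=(d-1)^{-1/2}\sum_{b\in\partial i\setminus a}\mathsf D_{i;b}f(\mathbf z^\ell_{\partial b\to b})$, $u^{\ell+1}_{i\to a}=w^{\ell+1}_{i\to a}-w^\ell_{i\to a}$, $z^{\ell+1}_{i\to a}=z_i^0+\sum_{s=1}^{\ell+1}A^{s-1}_{i\to a}u^s_{i\to a}$; $w^{\ell+1}_i=d^{-1/2}\sum_{b\in\partial i}\mathsf D_{i;b}f(\mathbf z^\ell_{\partial b\to b})$, $u^{\ell+1}_i=w^{\ell+1}_i-w^\ell_i$, $z^{\ell+1}_i=z_i^0+\sum_{s=1}^{\ell+1}A^{s-1}_iu^s_i$. Also $\mathbf z^\ell_{\partial a}=(z^\ell_{v_{a,1}},\dots,z^\ell_{v_{a,r}})$. Asymptotics: $r,f,\delta,L,K$ are fixed and $d\to\infty$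 along such hypergraphs (nonlinearities may depend on $d$); $O_d(g(d))$ denotes a quantity bounded in absolute value by $C g(d)$ with $C$ independent of $d$, of the hypergraph and of the chosen variables/factors; $o_d(1)$ denotes a quantity tending to $0$ as $d\to\infty$ in the same uniform sense; $\mathrm{plim}$ is limit in probability. Property (P1): for all $0\le\ell\le L-1$, variables $i$, factors $a\in\partial i$, $m\in\mathbb N$: $\mathbb E|A^\ell_i-A^\ell_{i\to a}|^m=O_d(d^{-m/2})$. Property (P2): for all such $\ell,i,a$: $\mathbb E[(A^\ell_i)^2]=\mathbb E[(A^\ell_{i\to a})^2]=\delta/\nu_{\ell+1}$. *)

(* Defs.v *)
From HB Require Import structures.
From mathcomp Require Import all_boot all_order all_algebra.
From mathcomp Require Import all_classical all_reals all_analysis.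
Set Implicit Arguments. Unset Strict Implicit. Unset Printing Implicit Defensive.
Import Order.TTheory GRing.Theory Num.Theory.
Local Open Scope ring_scope.

(** Boolean cube {+1,-1}^r is represented by {ffun 'I_r -> bool},
    with [true] standing for +1 and [false] for -1. *)
Section Fourier.
Context {R : realType}.
Definition spin (b : bool) : R := if b then 1 else -1.

Definition fhat (r : nat) (f : {ffun 'I_r -> bool} -> bool) (S : {set 'I_r}) : R :=
  (2 ^+ r)^-1 * \sum_(x : {ffun 'I_r -> bool}) (f x)%:R * \prod_(k in S) spin (x k).

Definition fext r f (x : 'I_r -> R) : R :=
  \sum_(S : {set 'I_r}) fhat f S * \prod_(k in S) x k.

Definition fder r f (k : 'I_r) (x : 'I_r -> R) : R :=
  \sum_(S : {set 'I_r} | k \in S) fhat f S * \prod_(j in S :\ k) x j.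
End Fourier.

Definition Lof {R : realType} (delta : R) : nat := Num.truncn (delta^-1).

Section Hypergraph.
Context {r : nat} {V E : finType} (inc : E -> 'I_r -> V).
(** [inc a k] is the k-th entry v_{a,k} of the factor a. *)

Definition incident (a : E) (i : V) : bool := [exists k, inc a k == i].

Definition index_regular (d : nat) : Prop :=
  (forall a, injective (inc a)) /\
  (forall i, #|[set a | incident a i]| = d) /\
  (forall i (k : 'I_r), (#|[set a | inc a k == i]| * r)%N = d).

(** a cycle of length 2k in the bipartite variable-factor graph:
    distinct variables vs_0..vs_{k-1}, distinct factors fs_0..fs_{k-1},
    with vs_j, vs_{j+1 mod k} both in fs_j. *)
Definition fg_cycle (k : nat) : Prop :=
  exists (vs : 'I_k -> V) (fs : 'I_k -> E),
    injective vs /\ injective fs /\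
    forall j : 'I_k, incident (fs j) (vs j) /\ incident (fs j) (vs (ordS j)).

Definition fg_girth_ge (g : nat) : Prop :=
  forall k, (2 <= k)%N -> (2 * k < g)%N -> ~ fg_cycle k.
End Hypergraph.

Section Algorithm.
Context {R : realType} {r : nat} (f : {ffun 'I_r -> bool} -> bool)
  {V E : finType} (inc : E -> 'I_r -> V) (d : nat)
  (Fm Fn : forall l : nat, l.-tuple R -> R) (z0 : V -> R).

Definition Dfac (a : E) (i : V) (x : 'I_r -> R) : R :=
  if [pick k | inc a k == i] is Some k then fder f k x else 0.

(** message quantities, from the list [w^0; ...; w^l] of messages *)
Definition nthm (wm : seq (V -> E -> R)) s := nth (fun _ _ => 0) wm s.
Definition umsg wm s i a : R := nthm wm s i a - nthm wm s.-1 i a.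
Definition Amsg wm s i a : R := Fm [tuple umsg wm k.+1 i a | k < s].
Definition zmsg wm l i a : R :=
  z0 i + \sum_(s < l) Amsg wm s i a * umsg wm s.+1 i a.

(** node quantities, from the list [w^0; ...; w^l] *)
Definition nthn (wn : seq (V -> R)) s := nth (fun _ => 0) wn s.
Definition unode wn s i : R := nthn wn s i - nthn wn s.-1 i.
Definition Anode wn s i : R := Fn [tuple unode wn k.+1 i | k < s].
Definition znode wn l i : R :=
  z0 i + \sum_(s < l) Anode wn s i * unode wn s.+1 i.

(** [wseq l] = ([w^0_{.->.}; ...; w^l_{.->.}], [w^0_.; ...; w^l_.]) *)
Fixpoint wseq (l : nat) : seq (V -> E -> R) * seq (V -> R) :=
  match l with
  | 0 => ([:: fun _ _ => 0], [:: fun _ => 0])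
  | l'.+1 =>
    let: (wm, wn) := wseq l' in
    (rcons wm (fun i a => (Num.sqrt (d%:R - 1))^-1 *
        \sum_(b | incident inc b i && (b != a))
           Dfac b i (fun k => zmsg wm l' (inc b k) b)),
     rcons wn (fun i => (Num.sqrt d%:R)^-1 *
        \sum_(b | incident inc b i)
           Dfac b i (fun k => zmsg wm l' (inc b k) b)))
  end.

Definition A_msg L l i a := Amsg (wseq L).1 l i a.
Definition A_node L l i := Anode (wseq L).2 l i.
Definition u_node L l i := unode (wseq L).2 l i.     (* u^l_i, l >= 1 *)
Definition z_node L l i := znode (wseq L).2 l i.
End Algorithm.

Section Gauss.
Context {R : realType} {V : finType}.
Local Open Scope classical_set_scope.
Definition iid_normal {dT} {T : measurableType dT} (P : probability T R)
  (Z : V -> T -> R) (v : R) : Prop :=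
  (forall i, measurable_fun setT (Z i)) /\
  (forall i (B : set R), measurable B ->
     P (Z i @^-1` B) = normal_prob 0 (Num.sqrt v) B) /\
  (forall B : V -> set R, (forall i, measurable (B i)) ->
     fine (P [set w | forall i, B i (Z i w)]) =
     \prod_(i : V) fine (P (Z i @^-1` B i))).
End Gauss.

Definition Ex {R : realType} {dT} {T : measurableType dT} (P : probability T R)
  (X : T -> R) : R := fine ('E_P[X])%E.

(* Main.v *)
Require Import Defs.
From HB Require Import structures.
From mathcomp Require Import all_boot all_order all_algebra.
From mathcomp Require Import all_classical all_reals all_analysis.
From mathcomp Require Import measurable_realfun zify ring lra.
Set Implicit Arguments. Unset Strict Implicit. Unset Printing Implicit Defensive.
Import Order.TTheory GRing.Theory Num.Theory.
Import numFieldTopology.Exports.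
Local Open Scope ring_scope.

(** Expand [f(z_a)] to second order around the messages [z_{i->a}].  The
    zeroth-order term has mean [fhat set0], because the messages entering [a]
    are orthogonal.  In the first-order term the gap [z_i - z_{i->a}] meets
    [D_i f(z_{da->a})]; the message part of the gap contributes nothing, and
    summing the node part over the factors at [i] turns [D_i f] into
    [sqrt d * w_i^(L+1) = sqrt d * (u_i^1 + ... + u_i^(L+1))], of which only
    [u_i^(s+1)] survives against [A_i^s u_i^(s+1)].  The second-order term is
    [O(1/d)] since [sqrt d * (z_i - z_{i->a})] has moments bounded uniformly.

    No independence is used beyond one consequence: the law of [z^0] is
    invariant under changing the sign of a single coordinate, so
    [E[z_k * G] = 0] when [G] ignores [z_k].  Unrolling the recursion, every
    orthogonality relation reduces to this one, with [k] a variable at maximal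
    depth of the local tree; the girth hypothesis ensures that the other factor
    ignores [k].  The moments of the normalized sums [w] are bounded from the
    same orthogonality, as for martingales. *)

(** The constant has to be fixed before [d], the hypergraph, the nonlinearities and the probability
    space. Every quantitative moment estimate is therefore carried by an explicit sequence
    [nat -> R] built from [r], [f], [delta], [K] and [C1]; mere integrability, whose bounds may
    depend on everything, is kept apart as [nice]. A moment of a product is bounded by moments of
    twice the order, so all even orders are carried along.

    Sign changes act on [V -> R] and not on the given sample space, so expectations are moved to the
    law of [z^0] on [V -> R].

    Orthogonality is proved one level at a time. A message grows by increments [A * u]; the [u] of
    level [s] is orthogonal to whatever ignores the signs of the variables at depth exactly [s],
    while its coefficient [A] stops at smaller depth. The initial value [z_i] counts as the
    increment of level 0, with coefficient 1. If two branches at a factor shared a variable at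
    depths at most [L], a closed walk of length at most [4 * L + 2] would result; this is what the
    girth bound [4 * L + 4] excludes. *)

Section PowerInequalities.
Context {R : realFieldType}.
Implicit Types x y s : R.

(** If [x ^+ 2 <= y ^+ 2] then [(x + y) ^+ 2 <= 4 * y ^+ 2]; the claim is the [p]-th power of
    this. *)
Lemma exprD2n_le x y p :
  (x + y) ^+ p.*2 <= 4 ^+ p * (x ^+ p.*2 + y ^+ p.*2).
Proof.
wlog xy : x y / x ^+ 2 <= y ^+ 2 => [H|].
  case: (leP (x ^+ 2) (y ^+ 2)) => [/H //|/ltW /H].
  by rewrite addrC (addrC (y ^+ _)).
rewrite -mul2n !exprM mulrDr -!exprMn.
apply: ler_wpDl; first by apply: exprn_ge0; rewrite mulr_ge0 ?sqr_ge0.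
apply: lerXn2r; [exact: sqr_ge0|by rewrite nnegrE mulr_ge0 ?sqr_ge0|].
have := sqr_ge0 (x - y); rewrite sqrrB sqrrD; move: (x ^+ 2) (y ^+ 2) xy (x * y) => a b ab c h; lra.
Qed.

Lemma exprM2n_le x y p :
  (x * y) ^+ p.*2 <= x ^+ p.*2.*2 + y ^+ p.*2.*2.
Proof.
rewrite exprMn -(mul2n p.*2) (mulnC 2) !exprM.
move: (x ^+ _) (y ^+ _) => a b; have := sqr_ge0 (a - b); rewrite sqrrB.
have := sqr_ge0 a; have := sqr_ge0 b; move: (a ^+ 2) (b ^+ 2) (a * b) => u v w ? ? ?; lra.
Qed.

Lemma expr_double_ge0 x p : 0 <= x ^+ p.*2.
Proof. by rewrite exprn_even_ge0// odd_double. Qed.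

Lemma normrXX_le x y n k : (k <= n.*2)%N ->
  `|x| ^+ (n.*2 - k) * `|y| ^+ k <= x ^+ n.*2 + y ^+ n.*2.
Proof.
move=> kn.
have e (z : R) : z ^+ n.*2 = `|z| ^+ n.*2 by rewrite -normrX; apply: esym; apply: ger0_norm; exact: expr_double_ge0.
rewrite (e x) (e y).
move: (normr_ge0 x) (normr_ge0 y); move: `|x| `|y| => a b a0 b0.
case: (leP a b) => [ab|/ltW ba].
- apply: (@le_trans _ _ (b ^+ n.*2)); last by rewrite lerDr exprn_ge0.
  by rewrite -[in leRHS](subnK kn) exprD ler_wpM2r ?exprn_ge0// lerXn2r.
- apply: (@le_trans _ _ (a ^+ n.*2)); last by rewrite lerDl exprn_ge0.
  by rewrite -[in leRHS](subnK kn) exprD ler_wpM2l ?exprn_ge0// lerXn2r.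
Qed.

(* The second-order Taylor bound behind the moment estimate for sums of
   martingale-like increments: [y] plays the role of [N^(-1/2)]. *)
Lemma exprD2n_taylor s x y p : 0 <= y -> y <= 1 ->
  (s + y * x) ^+ p.*2 <=
  s ^+ p.*2 + (p.*2)%:R * (y * (x * s ^+ p.*2.-1))
  + 4 ^+ p * y ^+ 2 * (s ^+ p.*2 + x ^+ p.*2).
Proof.
move=> y0 y1.
have hge : 0 <= 4 ^+ p * y ^+ 2 * (s ^+ p.*2 + x ^+ p.*2).
  by rewrite mulr_ge0 ?mulr_ge0 ?exprn_ge0// addr_ge0// expr_double_ge0.
case: p hge => [|p] hge.
  by rewrite !expr0 mul0r addr0; move: hge; rewrite !expr0; lra.
rewrite exprDn doubleS big_ord_recl big_ord_recl /= -addrA.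
rewrite /bump/= subn0 expr0 mulr1 bin0 mulr1n bin1 subn1 expr1 /=.
rewrite -mulr_natl; apply: lerD; first by [].
apply: lerD; first by rewrite [_ ^+ _ * (y * x)]mulrC -mulrA.
have M0 : 0 <= s ^+ p.*2.+2 + x ^+ p.*2.+2.
  by rewrite -!doubleS addr_ge0// expr_double_ge0.
have N0 : 0 <= y ^+ 2 * (s ^+ p.*2.+2 + x ^+ p.*2.+2) by rewrite mulr_ge0 ?sqr_ge0.
(* The terms of index at least two all satisfy [y ^+ i <= y ^+ 2]. Putting back the two missing
   indices completes the sum of binomial coefficients to [4 ^+ p.+1]. *)
apply: (@le_trans _ _ (\sum_(i < p.*2.+3)
   y ^+ 2 * (s ^+ p.*2.+2 + x ^+ p.*2.+2) *+ 'C(p.*2.+2, i))).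
  rewrite [leRHS]big_ord_recl big_ord_recl /= addrA.
  apply: ler_wpDl; first by rewrite addr_ge0// mulrn_wge0.
  apply: ler_sum => i _; rewrite /bump/= !add1n; apply: ler_wMn2r.
  have ile : (i.+2 <= p.+1.*2)%N by rewrite doubleS !ltnS -ltnS; exact: ltn_ord.
  apply: (le_trans (ler_norm _)).
  rewrite normrM exprMn normrM !normrX (ger0_norm y0).
  rewrite mulrCA; apply: ler_pM.
  + by rewrite exprn_ge0.
  + by rewrite mulr_ge0 ?exprn_ge0.
  + by rewrite -[i.+2]addn2 exprD ler_piMl ?exprn_ge0// exprn_ile1.
  + exact: (@normrXX_le s x p.+1).
rewrite sumrMnr.
have -> : (\sum_(i < p.*2.+3) 'C(p.*2.+2, i) = 2 ^ p.+1.*2)%N.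
  by rewrite -[RHS]/((1 + 1) ^ _)%N expnDn; apply: eq_bigr => i _; rewrite !exp1n !muln1.
by rewrite -[p.+1.*2]mul2n expnM -[X in X <= _]mulr_natl natrX -mulrA.
Qed.

End PowerInequalities.

(** * Moments *)

Section Moments.
Context d (T : measurableType d) (R : realType) (P : probability T R).
Implicit Types (X Y : T -> R) (B : nat -> R).

Definition integ X := P.-integrable setT (EFin \o X).

Lemma ExE X : Ex P X = Rintegral P setT X.
Proof. by rewrite /Ex /Rintegral unlock. Qed.

Lemma integ_meas X : integ X -> measurable_fun setT X.
Proof. by move/measurable_int/measurable_EFinP. Qed.

Lemma integ_dom X Y : measurable_fun setT X -> integ Y ->
  (forall x, `|X x| <= Y x) -> integ X.
Proof.
move=> mX iY XY; apply: (le_integrable measurableT) iY; first exact/measurable_EFinP.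
by move=> x _ /=; rewrite lee_fin (le_trans (XY x)) ?ler_norm.
Qed.

Lemma integ_cst (c : R) : integ (fun=> c).
Proof. exact: (finite_measure_integrable_cst P c measurableT). Qed.

Lemma integD X Y : integ X -> integ Y -> integ (fun x => X x + Y x).
Proof. by move=> iX iY; apply: (integrableD measurableT iX iY). Qed.

Lemma integZ (c : R) X : integ X -> integ (fun x => c * X x).
Proof. by move=> iX; apply: (integrableZl measurableT c iX). Qed.

Lemma integB X Y : integ X -> integ Y -> integ (fun x => X x - Y x).
Proof. by move=> iX iY; apply: (integrableB measurableT iX iY). Qed.

Lemma integ_sum I (s : seq I) (p : pred I) (F : I -> T -> R) :
  (forall i, p i -> integ (F i)) -> integ (fun x => \sum_(i <- s | p i) F i x).
Proof.
move=> h; elim: s => [|a s ih].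
  by under eq_fun do rewrite big_nil; exact: integ_cst.
case: (boolP (p a)) => pa.
  by under eq_fun do rewrite big_cons pa; exact: integD (h _ pa) ih.
by under eq_fun do rewrite big_cons (negbTE pa).
Qed.

Lemma Ex_ext X Y : X =1 Y -> Ex P X = Ex P Y.
Proof. by move/funext => ->. Qed.

Lemma Ex_cst (c : R) : Ex P (fun=> c) = c.
Proof.
rewrite ExE Rintegral_cst//.
by have /= -> := @probability_setT _ _ _ P; rewrite mulr1.
Qed.

Lemma ExD X Y : integ X -> integ Y -> Ex P (fun x => X x + Y x) = Ex P X + Ex P Y.
Proof. by move=> iX iY; rewrite !ExE; exact: RintegralD. Qed.

Lemma ExB X Y : integ X -> integ Y -> Ex P (fun x => X x - Y x) = Ex P X - Ex P Y.
Proof. by move=> iX iY; rewrite !ExE; exact: RintegralB. Qed.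

Lemma ExZ (c : R) X : integ X -> Ex P (fun x => c * X x) = c * Ex P X.
Proof. by move=> iX; rewrite !ExE; exact: RintegralZl. Qed.

Lemma Ex_sum I (s : seq I) (p : pred I) (F : I -> T -> R) :
  (forall i, p i -> integ (F i)) ->
  Ex P (fun x => \sum_(i <- s | p i) F i x) = \sum_(i <- s | p i) Ex P (F i).
Proof.
move=> h; elim: s => [|a s ih].
  by under Ex_ext do rewrite big_nil; rewrite Ex_cst big_nil.
rewrite big_cons; case: (boolP (p a)) => pa; last first.
  by under Ex_ext do rewrite big_cons (negbTE pa).
under Ex_ext do rewrite big_cons pa.
by rewrite ExD ?ih//; [exact: h|exact: integ_sum].
Qed.

Lemma Ex_le X Y : integ X -> integ Y -> (forall x, X x <= Y x) -> Ex P X <= Ex P Y.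
Proof. by move=> iX iY XY; rewrite !ExE; apply: le_Rintegral. Qed.

Lemma Ex_norm_le X Y : integ X -> integ Y -> (forall x, `|X x| <= Y x) ->
  `|Ex P X| <= Ex P Y.
Proof.
move=> iX iY XY; rewrite ler_norml; apply/andP; split.
  rewrite -mulN1r -(ExZ _ iY); apply: Ex_le => //; first exact: integZ.
  by move=> x; have := XY x; rewrite ler_norml mulN1r => /andP[].
by apply: Ex_le => // x; have := XY x; rewrite ler_norml => /andP[].
Qed.

(** Entry [B p] bounds the moment of order [2p]. Even orders avoid absolute values and make every
    moment an integral of a nonnegative function. *)
Definition mom B X := measurable_fun setT X /\
  forall p, integ (fun x => X x ^+ p.*2) /\ Ex P (fun x => X x ^+ p.*2) <= B p.

(** The qualitative version, stable under sums and products; it supplies the integrability behind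
    each use of linearity of [Ex]. *)
Definition nice X := exists B, mom B X.

Lemma mom_nice B X : mom B X -> nice X. Proof. by exists B. Qed.

Lemma mom_meas B X : mom B X -> measurable_fun setT X. Proof. by case. Qed.

Lemma mom_dom B X : measurable_fun setT X ->
  (forall p, exists Y, [/\ integ Y, forall x, X x ^+ p.*2 <= Y x & Ex P Y <= B p]) ->
  mom B X.
Proof.
move=> mX h; split=> // p; have [Y [iY XY YB]] := h p.
have iX : integ (fun x => X x ^+ p.*2).
  apply: integ_dom iY _; first exact: measurable_funX.
  by move=> x; rewrite ger0_norm// expr_double_ge0.
split=> //; exact: le_trans (Ex_le iX iY XY) YB.
Qed.

Lemma mom_le B1 B2 X : mom B1 X -> (forall p, B1 p <= B2 p) -> mom B2 X.
Proof. by case=> mX h b; split=> // p; have [? hp] := h p; split=> //; exact: le_trans hp (b p). Qed.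

Lemma mom_ext B X Y : X =1 Y -> mom B X -> mom B Y.
Proof. by move/funext => ->. Qed.

Definition cstB (c : R) : nat -> R := fun p => c ^+ p.*2.
Definition addB B1 B2 : nat -> R := fun p => 4 ^+ p * (B1 p + B2 p).
(** The arithmetic-geometric inequality in place of Cauchy-Schwarz: the bound stays a sum, at the
    price of doubling the order of the moments. *)
Definition mulB B1 B2 : nat -> R := fun p => B1 p.*2 + B2 p.*2.

Lemma mom_bdd X (c : R) : measurable_fun setT X -> (forall x, `|X x| <= c) ->
  mom (cstB c) X.
Proof.
move=> mX Xc; apply: mom_dom => // p; exists (fun=> c ^+ p.*2).
rewrite Ex_cst; split=> //; first exact: integ_cst.
move=> x; rewrite -[leLHS]ger0_norm ?expr_double_ge0// normrX.
by apply: lerXn2r (Xc x); rewrite nnegrE// (le_trans _ (Xc x)).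
Qed.

Lemma mom_cst (c : R) : mom (cstB c) (fun=> c).
Proof.
apply: mom_dom => // p; exists (fun=> c ^+ p.*2).
by rewrite Ex_cst; split=> //; exact: integ_cst.
Qed.

Lemma momD B1 B2 X Y : mom B1 X -> mom B2 Y -> mom (addB B1 B2) (fun x => X x + Y x).
Proof.
case=> mX hX [mY hY]; apply: mom_dom => [|p]; first exact: measurable_funD.
have [iX bX] := hX p; have [iY bY] := hY p.
exists (fun x => 4 ^+ p * (X x ^+ p.*2 + Y x ^+ p.*2)); split.
- by apply: integZ; exact: integD.
- by move=> x; exact: exprD2n_le.
- by rewrite ExZ ?ExD//; [rewrite ler_wpM2l ?exprn_ge0// lerD|exact: integD].
Qed.

Lemma momM B1 B2 X Y : mom B1 X -> mom B2 Y -> mom (mulB B1 B2) (fun x => X x * Y x).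
Proof.
case=> mX hX [mY hY]; apply: mom_dom => [|p]; first exact: measurable_funM.
have [iX bX] := hX p.*2; have [iY bY] := hY p.*2.
exists (fun x => X x ^+ p.*2.*2 + Y x ^+ p.*2.*2); split.
- exact: integD.
- by move=> x; exact: exprM2n_le.
- by rewrite ExD// lerD.
Qed.

Lemma momN B X : mom B X -> mom B (fun x => - X x).
Proof.
case=> mX hX; split=> [|p]; first exact: measurable_funN.
suff -> : (fun x => (- X x) ^+ p.*2) = (fun x => X x ^+ p.*2) by exact: hX.
by apply/funext => x; rewrite -mul2n !exprM sqrrN.
Qed.

Lemma momB B1 B2 X Y : mom B1 X -> mom B2 Y -> mom (addB B1 B2) (fun x => X x - Y x).
Proof. by move=> hX /momN; exact: momD. Qed.

Lemma mom_sum I (s : seq I) (p : pred I) (B : I -> nat -> R) (F : I -> T -> R) :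
  (forall i, p i -> mom (B i) (F i)) ->
  mom (\big[addB/cstB 0]_(i <- s | p i) B i) (fun x => \sum_(i <- s | p i) F i x).
Proof.
move=> h; elim: s => [|a s ih].
  by rewrite big_nil; apply: (mom_ext _ (mom_cst 0)) => x; rewrite big_nil.
rewrite big_cons; case: ifP => pa.
  by apply: (mom_ext _ (momD (h _ pa) ih)) => x; rewrite big_cons pa.
by apply: (mom_ext _ ih) => x; rewrite big_cons pa.
Qed.

Lemma mom_prod I (s : seq I) (p : pred I) (B : I -> nat -> R) (F : I -> T -> R) :
  (forall i, p i -> mom (B i) (F i)) ->
  mom (\big[mulB/cstB 1]_(i <- s | p i) B i) (fun x => \prod_(i <- s | p i) F i x).
Proof.
move=> h; elim: s => [|a s ih].
  by rewrite big_nil; apply: (mom_ext _ (mom_cst 1)) => x; rewrite big_nil.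
rewrite big_cons; case: ifP => pa.
  by apply: (mom_ext _ (momM (h _ pa) ih)) => x; rewrite big_cons pa.
by apply: (mom_ext _ ih) => x; rewrite big_cons pa.
Qed.

Lemma mom_norm_le1 x : `|x : R| <= 1 + x ^+ 1%N.*2.
Proof. 
rewrite -[x ^+ _]/(x ^+ 2) -real_normK ?num_real//.
have := sqr_ge0 (`|x| - 1); rewrite sqrrB mulr1 expr1n.
have := normr_ge0 x; move: (`|x| ^+ 2) `|x| => a b; lra.
Qed.

Lemma mom_integ B X : mom B X -> integ X.
Proof.
case=> mX /(_ 1%N)[iX _].
apply: (integ_dom mX (integD (integ_cst 1) iX)) => x; exact: mom_norm_le1.
Qed.

(** From [|x| <= 1 + x ^+ 2]. The final constant [1 + totB 1] has its form from here. *)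
Lemma mom_Ex_le B X : mom B X -> `|Ex P X| <= 1 + B 1%N.
Proof.
move=> mX; have iX := mom_integ mX; case: mX => mX /(_ 1%N)[iX2 XB].
apply: (le_trans (Ex_norm_le iX (integD (integ_cst 1) iX2) _)).
  by move=> x; exact: mom_norm_le1.
by rewrite ExD ?Ex_cst ?lerD2l//; exact: integ_cst.
Qed.

Lemma nice_integ X : nice X -> integ X. Proof. by case=> B /mom_integ. Qed.

Lemma nice_cst (c : R) : nice (fun=> c). Proof. by exists (cstB c); exact: mom_cst. Qed.

Lemma niceD X Y : nice X -> nice Y -> nice (fun x => X x + Y x).
Proof. by move=> [B1 h1] [B2 h2]; exists (addB B1 B2); exact: momD. Qed.

Lemma niceM X Y : nice X -> nice Y -> nice (fun x => X x * Y x).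
Proof. by move=> [B1 h1] [B2 h2]; exists (mulB B1 B2); exact: momM. Qed.

Lemma niceB X Y : nice X -> nice Y -> nice (fun x => X x - Y x).
Proof. by move=> [B1 h1] [B2 h2]; exists (addB B1 B2); exact: momB. Qed.

Lemma nice_sum I (s : seq I) (p : pred I) (F : I -> T -> R) :
  (forall i, p i -> nice (F i)) -> nice (fun x => \sum_(i <- s | p i) F i x).
Proof.
move=> h; elim: s => [|a s ih].
  by under eq_fun do rewrite big_nil; exact: nice_cst.
case: (boolP (p a)) => pa; last by under eq_fun do rewrite big_cons (negbTE pa).
by under eq_fun do rewrite big_cons pa; exact: niceD (h _ pa) ih.
Qed.

Lemma nice_prod I (s : seq I) (p : pred I) (F : I -> T -> R) :
  (forall i, p i -> nice (F i)) -> nice (fun x => \prod_(i <- s | p i) F i x).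
Proof.
move=> h; elim: s => [|a s ih].
  by under eq_fun do rewrite big_nil; exact: nice_cst.
case: (boolP (p a)) => pa; last by under eq_fun do rewrite big_cons (negbTE pa).
by under eq_fun do rewrite big_cons pa; exact: niceM (h _ pa) ih.
Qed.

Lemma niceX X n : nice X -> nice (fun x => X x ^+ n).
Proof.
move=> nX; elim: n => [|n ih]; first by under eq_fun do rewrite expr0; exact: nice_cst.
by under eq_fun do rewrite exprS; exact: niceM.
Qed.

(** With [N] summands and [N * y ^+ 2 <= 1], the growth factor [(1 + 4 ^+ p * y ^+ 2) ^+ N] is at
    most [expR (4 ^+ p)], whatever [N] is. *)
Definition sumB B : nat -> R := fun p => expR (4 ^+ p) * (1 + B p).

(* A discrete Gronwall argument: each summand multiplies the [2p]-th moment by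
   at most [1 + 4^p y^2], since the first-order term of the expansion vanishes
   by the orthogonality hypothesis. *)
Lemma mom_normalized_sum (I : eqType) (s : seq I) (y : R) B (F : I -> T -> R) :
  0 <= y -> (size s)%:R * y ^+ 2 <= 1 -> (forall p, 0 <= B p) -> uniq s ->
  (forall i, i \in s -> mom B (F i)) ->
  (forall i t n, i \in s -> {subset t <= s} -> i \notin t ->
     Ex P (fun x => F i x * (y * \sum_(j <- t) F j x) ^+ n) = 0) ->
  mom (sumB B) (fun x => y * \sum_(i <- s) F i x).
Proof.
move=> y0 sy B0 us hF h0.
have nF i : i \in s -> nice (F i) by move=> /hF; exact: mom_nice.
have nS t : {subset t <= s} -> nice (fun x => y * \sum_(j <- t) F j x).
  move=> ts; apply: niceM; first exact: nice_cst.
  under eq_fun do rewrite big_seq.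
  by apply: nice_sum => i /ts /nF.
split; first by have [B' /mom_meas] := nS s (fun _ => id).
move=> p; split; first by apply: nice_integ; apply: niceX; exact: nS.
pose c : R := 4 ^+ p * y ^+ 2.
have c0 : 0 <= c by rewrite mulr_ge0 ?exprn_ge0.
have Bp := B0 p.
(* Adding [B p] to the moment turns the affine recursion into a purely multiplicative one. The [1]
   in [1 + B p] covers the empty sum at [p = 0], where [0 ^+ 0 = 1]. *)
have key t : uniq t -> {subset t <= s} -> 
  Ex P (fun x => (y * \sum_(i <- t) F i x) ^+ p.*2) + B p <=
    (1 + c) ^+ size t * (1 + B p).
  elim: t => [_ _|a t ih /= /andP[at_ ut] ts].
    under Ex_ext do rewrite big_nil mulr0.
    rewrite Ex_cst expr0 mul1r lerD2r expr0n; by case: (_ == _).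
  have as_ : a \in s by apply: ts; rewrite mem_head.
  have ts' : {subset t <= s} by move=> i it; apply: ts; rewrite inE it orbT.
  have y1 : y <= 1.
    have s1 : (1 : R) <= (size s)%:R by rewrite ler1n; case: (s) as_.
    rewrite -(@ler_sqr R) ?nnegrE// expr1n; apply: le_trans sy.
    by rewrite ler_peMl// sqr_ge0.
  have {}ih := ih ut ts'.
  set S := (fun x => y * \sum_(i <- t) F i x).
  have nSt : nice S by exact: nS.
  have iS : integ (fun x => S x ^+ p.*2) by apply: nice_integ; exact: niceX.
  have [ia Ea] := (hF _ as_).2 p.
  have iaS : integ (fun x => F a x * S x ^+ p.*2.-1).
    by apply: nice_integ; apply: niceM; [exact: nF|exact: niceX].
  set g := fun x => (S x ^+ p.*2 + (p.*2%:R * y) * (F a x * S x ^+ p.*2.-1))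
      + c * (S x ^+ p.*2 + F a x ^+ p.*2).
  have ig : integ g.
    by apply: integD; [apply: integD => //; exact: integZ|apply: integZ; exact: integD].
  apply: (@le_trans _ _ (Ex P g + B p)).
    rewrite lerD2r; apply: Ex_le => //.
      by apply: nice_integ; apply: niceX; exact: nS.
    move=> x; rewrite big_cons mulrDr addrC /g /c.
    by apply: le_trans (exprD2n_taylor _ _ _ y0 y1) _; rewrite !mulrA.
  rewrite /g ExD; last 2 first.
  - by apply: integD => //; exact: integZ.
  - by apply: integZ; exact: integD.
  rewrite (ExD iS (integZ _ iaS)) (ExZ _ iaS) (ExZ _ (integD iS ia)) (ExD iS ia).
  rewrite /S h0// mulr0 addr0 exprS -mulrA.
  apply: (@le_trans _ _ ((1 + c) * (Ex P (fun x => S x ^+ p.*2) + B p))); last first.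
    by rewrite ler_wpM2l// addr_ge0.
  have : c * Ex P (fun x => F a x ^+ p.*2) <= c * B p by rewrite ler_wpM2l.
  rewrite -/S; lra.
apply: (@le_trans _ _ ((1 + c) ^+ size s * (1 + B p))).
  by apply: le_trans (key s us (fun _ => id)); rewrite lerDl.
rewrite /sumB ler_wpM2r ?addr_ge0//.
apply: (@le_trans _ _ (expR c ^+ size s)).
  by apply: lerXn2r; rewrite ?nnegrE ?addr_ge0 ?expR_ge0 ?expR_ge1Dx.
rewrite -expRM_natl ler_expR /c mulrCA ler_piMr ?exprn_ge0//.
Qed.

End Moments.

(** * The normal distribution *)

Local Notation image_measure :=
  measure_function_pushforward__canonical__measure_function_Measure.

Section NormalFacts.
Context {R : realType}.
Local Open Scope classical_set_scope.
Local Notation leb := (@lebesgue_measure R).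

(** By uniqueness of Lebesgue measure, since reflecting []a, b]] gives a half-open interval of the
    same length. *)
Lemma lebesgue_measure_opp (A : set R) : measurable A ->
  leb (-%R @^-1` A) = leb A.
Proof.
move=> mA; apply: esym.
have mo : measurable_fun setT (-%R : measurableTypeR R -> measurableTypeR R).
  exact: measurable_funN.
pose m := image_measure leb mo.
suff h : forall X, ocitv X -> leb X = m X by exact: (lebesgue_measure_unique h mA).
move=> X [[a b] _ <-] /=.
rewrite /pushforward.
have -> : -%R @^-1` `]a, b]%classic = `[(- b)%R, (- a)%R[%classic.
  by apply/seteqP; split=> x /=; rewrite !in_itv/= => /andP[]; rewrite lerNl ltrNr => -> ->.
rewrite !lebesgue_measure_itv/= !lte_fin ltrN2; case: ifP => // _.
by rewrite -!EFinD opprK addrC.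
Qed.

Lemma normal_prob_opp (s : R) (A : set R) : s != 0 -> measurable A ->
  normal_prob 0 s (-%R @^-1` A) = normal_prob 0 s A.
Proof.
move=> s0 mA.
have mo : measurable_fun setT (-%R : measurableTypeR R -> measurableTypeR R).
  exact: measurable_funN.
rewrite /normal_prob.
pose m := image_measure leb mo.
transitivity (\int[m]_(x in A) (normal_pdf 0 s x)%:E)%E.
  rewrite ge0_integral_pushforward//=.
  - by apply: eq_integral => x _ /=; rewrite normal_pdfE// /normal_fun !subr0 sqrrN.
  - by apply/measurable_EFinP; apply: measurable_funTS; exact: measurable_normal_pdf.
  - by move=> x _; rewrite lee_fin normal_pdf_ge0.
by apply: eq_measure_integral => B mB _; exact: lebesgue_measure_opp.
Qed.

(** The normal density and the Radon-Nikodym derivative have the same integral over every measurable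
    set, hence agree almost everywhere. *)
Lemma ge0_integral_normal_prob (m s : R) (g : R -> \bar R) :
  measurable_fun setT g -> (forall x, 0 <= g x)%E ->
  (\int[normal_prob m s]_x g x = \int[leb]_x (g x * (normal_pdf m s x)%:E))%E.
Proof.
move=> mg g0.
have dom := normal_prob_dominates m s.
rewrite -(Radon_Nikodym_SigmaFinite.change_of_variables dom)//.
have mf : measurable_fun setT (Radon_Nikodym_SigmaFinite.f (normal_prob m s) leb).
  exact: measurable_int (Radon_Nikodym_SigmaFinite.f_integrable dom).
have mp : measurable_fun setT (fun x => (normal_pdf m s x)%:E).
  by apply/measurable_EFinP; exact: measurable_normal_pdf.
apply: ae_eq_integral => //.
- exact: emeasurable_funM.
- exact: emeasurable_funM.
- apply: ae_eqe_mul2l; apply: integral_ae_eq => //.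
  + exact: Radon_Nikodym_SigmaFinite.f_integrable.
  + by move=> E _ mE; rewrite -Radon_Nikodym_SigmaFinite.f_integral.
Qed.

(* [x^(2p)] times the density of variance [v] is at most this constant times the
   density of variance [2v]. *)
Definition gaussB (v : R) : nat -> R := fun p =>
  (4 * v) ^+ p * p`!%:R * (normal_peak (Num.sqrt v) / normal_peak (Num.sqrt (2 * v))).

Lemma exprn_le_expR (y : R) p : 0 <= y -> y ^+ p <= p`!%:R * expR y.
Proof.
move=> y0; case: p => [|p].
  by rewrite expr0 fact0 mul1r -expR0 ler_expR.
have := expR_ge1Dxn p y0; have f0 : 0 < p.+1`!%:R :> R by rewrite ltr0n fact_gt0.
rewrite -ler_pdivrMl// mulrC => h; apply: le_trans h; by rewrite lerDr.
Qed.

(** With [y = x ^+ 2 / (4 * v)] the exponential splits as [expR (- y) * expR (- y)]. One factor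
    absorbs [y ^+ p] at the cost of [p!], the other is the exponential in the density of variance
    [2 * v]. *)
Lemma normal_pdf_moment (v x : R) p : 0 < v ->
  x ^+ p.*2 * normal_pdf 0 (Num.sqrt v) x <=
  gaussB v p * normal_pdf 0 (Num.sqrt (2 * v)) x.
Proof.
move=> v0.
have sv0 : Num.sqrt v != 0 by rewrite gt_eqF// sqrtr_gt0.
have s2v0 : Num.sqrt (2 * v) != 0 by rewrite gt_eqF// sqrtr_gt0 mulr_gt0.
rewrite !normal_pdfE// /gaussB /normal_fun !subr0 !sqr_sqrtr ?mulr_ge0 ?(ltW v0)//.
set a := normal_peak (Num.sqrt v); set b := normal_peak (Num.sqrt (2 * v)).
have a0 : 0 < a by exact: normal_peak_gt0.
have b0 : 0 < b by exact: normal_peak_gt0.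
pose y := x ^+ 2 / (4 * v).
have y0 : 0 <= y by rewrite divr_ge0 ?sqr_ge0 ?mulr_ge0// ltW.
have -> : - x ^+ 2 / (v *+ 2) = - y + - y by rewrite /y; field; rewrite gt_eqF.
have -> : - x ^+ 2 / (2 * v *+ 2) = - y by rewrite /y; field; rewrite gt_eqF.
have -> : x ^+ p.*2 = (4 * v) ^+ p * y ^+ p.
  by rewrite -exprMn -mul2n exprM; congr (_ ^+ p); rewrite /y; field; rewrite gt_eqF.
rewrite expRD.
have -> : (4 * v) ^+ p * p`!%:R * (a / b) * (b * expR (- y)) =
   (4 * v) ^+ p * a * expR (- y) * (p`!%:R * (expR y * expR (- y))).
  by rewrite -expRD subrr expR0; field; rewrite gt_eqF.
have -> : (4 * v) ^+ p * y ^+ p * (a * (expR (- y) * expR (- y))) =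
   (4 * v) ^+ p * a * expR (- y) * (y ^+ p * expR (- y)) by ring.
apply: ler_wpM2l.
  by rewrite !mulr_ge0 ?exprn_ge0 ?mulr_ge0 ?expR_ge0 ?(ltW v0) ?(ltW a0).
by rewrite mulrA; apply: ler_wpM2r; [exact: expR_ge0|exact: exprn_le_expR].
Qed.

Lemma normal_prob_moment (v : R) p : 0 < v ->
  (\int[normal_prob 0 (Num.sqrt v)]_x (x ^+ p.*2)%:E <= (gaussB v p)%:E)%E.
Proof.
move=> v0.
rewrite ge0_integral_normal_prob; last 2 first.
- by apply/measurable_EFinP; exact: measurable_funX.
- by move=> x; rewrite lee_fin expr_double_ge0.
have i2 := integrable_normal_pdf 0 (Num.sqrt (2 * v)).
have C0 : 0 <= gaussB v p.
  apply: mulr_ge0; last by apply: divr_ge0; exact: normal_peak_ge0.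
  by apply: mulr_ge0 => //; apply: exprn_ge0; apply: mulr_ge0 => //; exact: ltW.
apply: (@le_trans _ _ (\int[leb]_x ((gaussB v p)%:E * (normal_pdf 0 (Num.sqrt (2 * v)) x)%:E))%E).
  apply: ge0_le_integral => //=.
  - by move=> x _; rewrite mule_ge0// lee_fin ?expr_double_ge0 ?normal_pdf_ge0.
  - apply: emeasurable_funM; apply/measurable_EFinP; first exact: measurable_funX.
    exact: measurable_normal_pdf.
  - by apply: emeasurable_funM => //; apply/measurable_EFinP; exact: measurable_normal_pdf.
  - by move=> x _; rewrite -!EFinM lee_fin normal_pdf_moment.
rewrite integralZl// integral_normal_pdf mule1//.
Qed.

End NormalFacts.

(** * The law of the initial field *)

Section CoordinateSpace.
Context {V : finType} {R : realType}.
Local Open Scope classical_set_scope.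

Definition rectangles : set (set (V -> R)) :=
  [set A | exists B : V -> set R, (forall i, measurable (B i)) /\
             A = [set z | forall i, B i (z i)]].

(** The product sigma-algebra on [V -> R]. Its generators are stable under intersection and are the
    very sets on which the i.i.d. hypothesis prescribes the law. *)
Definition cspace : Type := g_sigma_algebraType rectangles.
HB.instance Definition _ := Measurable.on cspace.

Definition flip (k : V) (z : V -> R) : V -> R :=
  fun i => if i == k then - z i else z i.

Lemma flipE k z i : i != k -> flip k z i = z i.
Proof. by rewrite /flip => /negbTE ->. Qed.

Lemma measurable_rectangle (B : V -> set R) : (forall i, measurable (B i)) ->
  measurable ([set z | forall i, B i (z i)] : set cspace).
Proof. by move=> mB; apply: sub_sigma_algebra; exists B. Qed.

Lemma measurable_coord (i : V) : measurable_fun setT (fun z : cspace => z i).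
Proof.
move=> _ A mA; rewrite setTI.
have -> : (fun z : cspace => z i) @^-1` A =
    [set z | forall j, (if j == i then A else setT) (z j)].
  apply/seteqP; split=> z /= h; last by have := h i; rewrite eqxx.
  by move=> j; case: eqP => // ->.
by apply: (@measurable_rectangle (fun j => if j == i then A else setT)) => j; case: ifP.
Qed.

Lemma measurable_to_cspace d (T : measurableType d) (g : T -> cspace) :
  (forall i, measurable_fun setT (fun x => g x i)) -> measurable_fun setT g.
Proof.
move=> mg; apply: (@measurability _ _ T cspace setT g rectangles) => // _ [_ [B [mB ->]] <-].
rewrite setTI.
have -> : g @^-1` [set z | forall i, B i (z i)] =
    \bigcap_(i in [set` finset.setT : {set V}]) ((fun x => g x i) @^-1` B i).
  apply/seteqP; split => [x h i _|x h i]; first exact: h.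
  by apply: h; rewrite /= finset.in_setT.
apply: fin_bigcap_measurable; first exact: finite_finset.
by move=> i _; rewrite -[X in measurable X]setTI; exact: mg.
Qed.

Lemma measurable_flip k : measurable_fun setT (flip k : cspace -> cspace).
Proof.
apply: measurable_to_cspace => i; rewrite /flip; case: (i == k).
- by apply: measurable_funN; apply: measurable_coord.
- exact: measurable_coord.
Qed.

Lemma rectangles_setI : setI_closed rectangles.
Proof.
move=> _ _ [B [mB ->]] [C [mC ->]]; exists (fun i => B i `&` C i); split.
  by move=> i; exact: measurableI.
apply/seteqP; split => z /=; first by move=> [h1 h2] i; split.
by move=> h; split=> i; have [] := h i.
Qed.

Lemma cspace_measure_unique (m1 m2 : {measure set cspace -> \bar R}) :
  (m1 setT < +oo)%E -> (forall A, rectangles A -> m1 A = m2 A) ->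
  forall A, measurable A -> m1 A = m2 A.
Proof.
move=> m1oo h A mA; apply: (@measure_unique _ R cspace rectangles (fun=> setT)) => //.
- exact: rectangles_setI.
- move=> _; exists (fun=> setT); split => //.
  by apply/seteqP; split.
- by rewrite bigcup_const//; exists 0%N.
Qed.

Definition flip_invariant (mu : probability cspace R) :=
  forall k (A : set cspace), measurable A -> mu (flip k @^-1` A) = mu A.

(** The flip preserves the law and negates the integrand, so the mean equals its own opposite. *)
Lemma Ex_coord_mul0 (mu : probability cspace R) k (G : cspace -> R) :
  flip_invariant mu -> integ mu (fun z => z k * G z) ->
  (forall z, G (flip k z) = G z) -> Ex mu (fun z => z k * G z) = 0.
Proof.
move=> inv iG fG.
set H : cspace -> R := fun z => z k * G z.
have mf := measurable_flip k.
have Hf : (fun z => H (flip k z)) = (fun z => -1 * H z).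
  by apply/funext => z; rewrite /H fG /flip eqxx mulN1r mulNr.
pose m := image_measure mu mf.
have e : (\int[m]_z (H z)%:E = \int[mu]_z (H z)%:E)%E.
  by apply: eq_measure_integral => A mA _; exact: (inv k A mA).
have mH : measurable_fun setT (EFin \o H) := measurable_int mu iG.
have : Ex mu (fun z => H (flip k z)) = Ex mu H.
  rewrite !ExE /Rintegral -e integral_pushforward//.
  rewrite preimage_setT; have -> : (EFin \o H) \o flip k = EFin \o (fun z => -1 * H z).
    by rewrite -Hf.
  exact: integZ.
by rewrite Hf ExZ//; lra.
Qed.

Context d (T : measurableType d) (P : probability T R) (Z : V -> T -> R) (v : R).
Hypotheses (iidZ : iid_normal P Z v) (v0 : 0 < v).

Definition cspace_map (w : T) : cspace := fun i => Z i w.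

Lemma measurable_cspace_map : measurable_fun setT cspace_map.
Proof. by apply: measurable_to_cspace => i; exact: iidZ.1. Qed.

HB.instance Definition _ := isMeasurableFun.Build _ _ _ _ cspace_map measurable_cspace_map.

Definition cspace_law : probability cspace R := distribution P (cspace_map : {mfun T >-> cspace}).

Let sv0 : Num.sqrt v != 0. Proof. by rewrite gt_eqF// sqrtr_gt0. Qed.

Lemma rectangle_law (B : V -> set R) : (forall i, measurable (B i)) ->
  fine (cspace_law [set z | forall i, B i (z i)]) =
  \prod_i fine (normal_prob 0 (Num.sqrt v) (B i)).
Proof.
move=> mB; rewrite /cspace_law/= /distribution /pushforward.
transitivity (fine (P [set w | forall i, B i (Z i w)])); first by [].
rewrite iidZ.2.2//; apply: eq_bigr => i _; by rewrite iidZ.2.1.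
Qed.

(** Rectangles suffice by uniqueness; there the flip only reflects the side [B k], whose mass under
    a centred normal law does not change. *)
Lemma cspace_law_flip : flip_invariant cspace_law.
Proof.
move=> k A mA; have mf := measurable_flip k.
pose m := image_measure cspace_law mf.
apply: (@cspace_measure_unique m cspace_law _ _ A mA).
  by rewrite /m/= /pushforward preimage_setT probability_setT ltry.
move=> _ [B [mB ->]]; rewrite /m/= /pushforward.
pose B' i := if i == k then -%R @^-1` B i else B i.
have mB' i : measurable (B' i).
  rewrite /B'; case: ifP => // _; rewrite -[X in measurable X]setTI.
  exact: (measurable_funN (@measurable_id _ R setT)).
have -> : flip k @^-1` [set z | forall i, B i (z i)] =
    [set z | forall i, B' i (z i)].
  by apply/seteqP; split => z /= h i; have := h i; rewrite /flip /B'; case: ifP.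
have fin (C : set cspace) : measurable C -> cspace_law C \is a fin_num.
  by move=> mC; exact: fin_num_measure.
rewrite -[LHS]fineK; last by apply: fin; exact: measurable_rectangle.
rewrite -[RHS]fineK; last by apply: fin; exact: measurable_rectangle.
rewrite !rectangle_law//; congr (_%:E); apply: eq_bigr => i _.
by rewrite /B'; case: ifP => // _; rewrite normal_prob_opp.
Qed.

Lemma cspace_law_ge0 (G : cspace -> R) : measurable_fun setT G -> (forall z, 0 <= G z) ->
  (\int[P]_w (G (cspace_map w))%:E = \int[cspace_law]_z (G z)%:E)%E.
Proof.
move=> mG G0; rewrite ge0_integral_distribution//.
by apply/measurable_EFinP.
Qed.

Lemma cspace_law_Ex (G : cspace -> R) : integ cspace_law G ->
  Ex P (fun w => G (cspace_map w)) = Ex cspace_law G.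
Proof.
move=> iG; rewrite !ExE /Rintegral integral_distribution//.
  exact: (measurable_int _ iG).
have mG := integ_meas iG.
apply/integrableP; split.
  by apply/measurable_EFinP; apply: (measurableT_comp mG); exact: measurable_cspace_map.
have /integrableP[_ lt] := iG.
have mn : measurable_fun setT (fun z : cspace => `|G z|) by exact: measurableT_comp.
exact: (eq_ind_r (fun u => (u < +oo)%E) lt (cspace_law_ge0 mn (fun z => normr_ge0 (G z)))).
Qed.

Lemma cspace_law_mom i : mom cspace_law (gaussB v) (fun z => z i).
Proof.
have mi := measurable_coord i.
have E p : (\int[cspace_law]_z ((z i) ^+ p.*2)%:E <= (gaussB v p)%:E)%E.
  rewrite -(cspace_law_ge0 (G := fun z => z i ^+ p.*2)); last 2 first.
  - exact: measurable_funX.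
  - by move=> z; exact: expr_double_ge0.
  apply: le_trans (normal_prob_moment p v0).
  have mZ : measurable_fun setT (Z i : T -> measurableTypeR R) := iidZ.1 i.
  pose m := image_measure P mZ.
  have -> : (\int[normal_prob 0 (Num.sqrt v)]_x (x ^+ p.*2)%:E = \int[m]_x (x ^+ p.*2)%:E)%E.
    by apply: (@eq_measure_integral _ (measurableTypeR R) R setT m) => A mA _; rewrite /m/= /pushforward iidZ.2.1.
  rewrite ge0_integral_pushforward//=; first by apply/measurable_EFinP; exact: measurable_funX.
  by move=> x _; rewrite lee_fin expr_double_ge0.
split=> // p.
have i2 : integ cspace_law (fun z => z i ^+ p.*2).
  apply/integrableP; split; first by apply/measurable_EFinP; exact: measurable_funX.
  under eq_integral do rewrite /= ger0_norm ?expr_double_ge0//.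
  by apply: le_lt_trans (E p) _; rewrite ltry.
split=> //; rewrite ExE -lee_fin /Rintegral fineK//.
exact: integrable_fin_num.
Qed.

End CoordinateSpace.

(** * Cycles and local trees *)

Section NonBacktracking.
Context {r : nat} {V E : finType} (inc : E -> 'I_r -> V).

Definition adj (x y : V + E) : bool :=
  match x, y with
  | inl i, inr b => incident inc b i
  | inr b, inl i => incident inc b i
  | _, _ => false
  end.

(** [x] is total, but only indices up to [m] are constrained. For a closed walk nothing is required
    at the base point, where a backtrack is allowed. *)
Definition nbwalk (x : nat -> V + E) m :=
  (forall t, (t < m)%N -> adj (x t) (x t.+1)) /\
  (forall t, (t.+1 < m)%N -> x t <> x t.+2).

Definition is_var (x : V + E) : bool := if x is inl _ then true else false.

Lemma adj_sym x y : adj x y = adj y x. Proof. by case: x y => ? []. Qed.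

Lemma adj_is_var x y : adj x y -> is_var y = ~~ is_var x.
Proof. by case: x y => ? []. Qed.

Lemma nbwalk_parity x m p t : nbwalk x m -> (p + t <= m)%N ->
  is_var (x (p + t)%N) = is_var (x p) (+) odd t.
Proof.
move=> [xa _]; elim: t => [|t ih] h; first by rewrite addn0 addbF.
rewrite addnS in h *; rewrite (adj_is_var (xa _ h)) ih 1?ltnW//=.
by case: (is_var _) (odd t) => [] [].
Qed.

(** A closed segment without inner repetition is a cycle: bipartiteness makes [n] even, and [n = 2]
    would be a backtrack. *)
Lemma nbwalk_sub_cycle x m p n : nbwalk x m -> (0 < n)%N -> (p + n <= m)%N ->
  x p = x (p + n)%N ->
  (forall s t, (p <= s)%N -> (s < t)%N -> (t <= p + n)%N -> (t - s < n)%N -> x s <> x t) ->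
  exists k, [/\ (2 <= k)%N, (2 * k <= m)%N & fg_cycle inc k].
Proof.
move=> nx n0 pnm xpn inj; have [xa xb] := nx.
have /esym := nbwalk_parity nx pnm; rewrite -xpn => par.
have on : ~~ odd n by move: par; case: (is_var _) (odd n) => [] [].
have [k nk] : exists k, n = (2 * k)%N by exists n./2; rewrite mul2n even_halfK.
have k1 : (1 < k)%N.
  case: (ltngtP k 1) => [k1|//|k1]; first by lia.
  have n2 : n = 2%N by lia.
  by exfalso; apply: (xb p); [lia|rewrite xpn n2 addn2].
exists k; split => //; first by rewrite -nk; lia.
(* [fg_cycle] starts with a variable, so reading begins at the first variable of the segment. If
   that is [p.+1], the last factor sits at [p + n] and is [x p]. *)
pose s0 := if is_var (x p) then p else p.+1.
have s0p : (p <= s0 <= p.+1)%N by rewrite /s0; case: ifP; rewrite leqnn ?leqnSn.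
have s0v : is_var (x s0).
  rewrite /s0; case: ifP => // vp; rewrite (@adj_is_var (x p)) ?vp//; apply: xa; lia.
have side t : (s0 + t <= m)%N -> is_var (x (s0 + t)%N) = ~~ odd t.
  by move=> /(nbwalk_parity nx) ->; rewrite s0v.
have [v0 _] : exists v0 : V, True by move: s0v; case: (x s0) => // v _; exists v.
have [f0 _] : exists f0 : E, True.
  have : is_var (x (s0 + 1)%N) = false by rewrite side//; lia.
  by case: (x _) => // e _; exists e.
pose getv (y : V + E) : V := if y is inl v then v else v0.
pose gete (y : V + E) : E := if y is inr e then e else f0.
pose vs (j : 'I_k) := getv (x (s0 + 2 * j)%N).
pose fs (j : 'I_k) := gete (x (s0 + (2 * j).+1)%N).
have odd2 t : odd (2 * t) = false by rewrite mul2n odd_double.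
have vsE (j : 'I_k) : x (s0 + 2 * j)%N = inl (vs j).
  have := ltn_ord j => jk.
  have : is_var (x (s0 + 2 * j)%N) by rewrite side ?odd2//; lia.
  by rewrite /vs; case: (x _).
have fsE (j : 'I_k) : x (s0 + (2 * j).+1)%N = inr (fs j).
  have := ltn_ord j => jk.
  have : is_var (x (s0 + (2 * j).+1)%N) = false by rewrite side /= ?odd2//; lia.
  by rewrite /fs; case: (x _).
have injx (o : nat -> nat) : (forall j : 'I_k, p <= s0 + o j <= p + n)%N ->
    (forall i j : 'I_k, (i < j)%N -> (s0 + o i < s0 + o j)%N /\ (o j - o i < n)%N) ->
    forall i j : 'I_k, x (s0 + o i)%N = x (s0 + o j)%N -> i = j.
  move=> ob olt i j e; apply: val_inj; case: (ltngtP i j) => //= ij.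
  - have [h1 h2] := olt _ _ ij; have := ob i; have := ob j => *.
    by case: (inj (s0 + o i)%N (s0 + o j)%N) => //; lia.
  - have [h1 h2] := olt _ _ ij; have := ob i; have := ob j => *.
    by case: (inj (s0 + o j)%N (s0 + o i)%N) => //; lia.
exists vs, fs; split; [|split].
- move=> i j e; apply: (injx (fun j => 2 * j)%N); last by rewrite !vsE e.
  + by move=> l; have := ltn_ord l; lia.
  + by move=> a b; have := ltn_ord a; have := ltn_ord b; lia.
- move=> i j e; apply: (injx (fun j => (2 * j).+1)%N); last by rewrite !fsE e.
  + by move=> l; have := ltn_ord l; lia.
  + by move=> a b; have := ltn_ord a; have := ltn_ord b; lia.
move=> j; have jk := ltn_ord j; split.
  have : adj (x (s0 + 2 * j)%N) (x (s0 + 2 * j).+1) by apply: xa; lia.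
  by rewrite -addnS vsE fsE.
case: (ltnP j.+1 k) => jk1.
  have : adj (x (s0 + (2 * j).+1)%N) (x (s0 + (2 * j).+1).+1) by apply: xa; lia.
  have -> : (s0 + (2 * j).+1).+1 = (s0 + 2 * ordS j)%N by rewrite /= modn_small//; lia.
  by rewrite vsE fsE.
have jE : j = k.-1 :> nat by lia.
have oj : ordS j = 0%N :> nat.
  by rewrite /= (_ : j.+1 = k) ?modnn//; lia.
have := fsE j; have := vsE (ordS j); rewrite oj muln0 addn0 => v0E f0E.
suff : adj (x (s0 + (2 * j).+1)%N) (x s0) by rewrite v0E f0E.
rewrite /s0 in v0E f0E *; move: v0E f0E; case: ifP => _ _ _.
- rewrite xpn; have -> : (p + n = (p + (2 * j).+1).+1)%N by lia.
  by apply: xa; lia.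
- have -> : (p.+1 + (2 * j).+1 = p + n)%N by lia.
  by rewrite -xpn; apply: xa; lia.
Qed.

(** Strong induction on the length of a closed segment: any inner repetition gives a strictly
    shorter one. *)
Lemma nbwalk_cycle x m : nbwalk x m -> (0 < m)%N -> x 0%N = x m ->
  exists k, [/\ (2 <= k)%N, (2 * k <= m)%N & fg_cycle inc k].
Proof.
move=> nx m0 xm.
suff : forall n p, (0 < n)%N -> (p + n <= m)%N -> x p = x (p + n)%N ->
    exists k, [/\ (2 <= k)%N, (2 * k <= m)%N & fg_cycle inc k].
  by move/(_ m 0%N m0 (leqnn m) xm).
elim/ltn_ind => n ih p n0 pnm xpn.
have [[s [t [ps st tp ts e]]]|none] := pselect (exists s t, [/\ (p <= s)%N,
   (s < t)%N, (t <= p + n)%N, (t - s < n)%N & x s = x t]).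
- have st' := ltnW st; apply: (ih _ ts s); rewrite ?subn_gt0 ?subnKC//.
  exact: leq_trans tp pnm.
- refine (nbwalk_sub_cycle nx n0 pnm xpn _) => s t h1 h2 h3 h4 e; apply: none.
  by exists s, t.
Qed.

Definition consw a (x : nat -> V + E) t := if t is t'.+1 then x t' else a.

Lemma nbwalk_cons a x m : adj a (x 0%N) -> (0 < m -> a <> x 1%N)%N -> nbwalk x m ->
  nbwalk (consw a x) m.+1.
Proof.
move=> ax a1 [xa xb]; split=> -[tm|t tm] //=.
- exact: xa.
- exact: a1.
- exact: xb.
Qed.

(** Walk back along [x], then forward along [y]. The turn at the common start is no backtrack
    because the first steps differ, and the common end is the base point of the closed walk. *)
Lemma nbwalk_two x y m n : nbwalk x m -> nbwalk y n -> (0 < m)%N -> (0 < n)%N ->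
  x 0%N = y 0%N -> x 1%N <> y 1%N -> x m = y n ->
  exists k, [/\ (2 <= k)%N, (2 * k <= m + n)%N & fg_cycle inc k].
Proof.
move=> [xa xb] [ya yb] m0 n0 e0 e1 em.
apply: (@nbwalk_cycle (fun t => if (t <= m)%N then x (m - t)%N else y (t - m)%N)).
- split=> t tm; case: ifP => h1; case: ifP => h2.
  + have -> : (m - t = (m - t.+1).+1)%N by lia.
    by rewrite adj_sym; apply: xa; lia.
  + have -> : t = m by lia.
    by rewrite subnn subSnn e0; apply: ya.
  + by exfalso; lia.
  + have -> : (t.+1 - m = (t - m).+1)%N by lia.
    by apply: ya; lia.
  + have -> : (m - t = (m - t.+2).+2)%N by lia.
    by apply/nesym; apply: xb; lia.
  + have [tE|tE] := eqVneq t m.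
      have -> : (t.+2 - m = 2)%N by lia.
      by rewrite tE subnn e0; apply: yb; lia.
    have -> : (t.+2 - m = 1)%N by lia.
    by have -> : (m - t = 1)%N by lia.
  + by exfalso; lia.
  + have -> : (t.+2 - m = (t - m).+2)%N by lia.
    by apply: yb; lia.
- by lia.
- rewrite leq0n subn0 em; case: ifP; last by rewrite addKn.
  by lia.
Qed.

(* [lam t i o k]: [k] has depth exactly [t] in the tree rooted at [i], where the
   branch through the factor [o], if any, is removed. *)
Fixpoint lam t i (o : option E) (k : V) : Prop :=
  if t is t'.+1 then
    exists b kap, [/\ incident inc b i, Some b != o, inc b kap != i &
                      lam t' (inc b kap) (Some b) k]
  else i = k.

Lemma incident_inc b kap : incident inc b (inc b kap).
Proof. by apply/existsP; exists kap. Qed.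

(** Starting at the removed factor [b] makes the first step record the branch; the two inequalities
    in [lam] are exactly the absence of backtracking. *)
Lemma lam_walk t i b k : incident inc b i -> lam t i (Some b) k ->
  exists x, [/\ nbwalk x (2 * t).+1, x 0%N = inr b, x 1%N = inl i & x (2 * t).+1 = inl k].
Proof.
elim: t i b => [|t ih] i b bi /=.
  move=> <-; exists (fun s => if s is 0%N then inr b else inl i); split=> //.
  by split=> [[|s]|s]//.
move=> [c [kap [ci cb ne /(ih _ _ (incident_inc c kap)) [x [nx x0 x1 xk]]]]].
exists (consw (inr b) (consw (inl i) x)); split=> //; last first.
  by have -> : ((2 * t.+1).+1 = (2 * t).+3)%N by lia.
have -> : ((2 * t.+1).+1 = (2 * t).+3)%N by lia.
apply: nbwalk_cons => //=.
  by move=> _; rewrite x0 => -[bc]; move: cb; rewrite bc eqxx.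
apply: nbwalk_cons => //=; first by rewrite x0.
by move=> _; rewrite x1 => -[bc]; move: ne; rewrite bc eqxx.
Qed.

Variable g : nat.
Hypothesis girth : fg_girth_ge inc g.

Lemma no_short_cycle m : (m < g)%N ->
  ~ exists k, [/\ (2 <= k)%N, (2 * k <= m)%N & fg_cycle inc k].
Proof. by move=> mg [k [k2 km]]; apply: girth => //; lia. Qed.

(** The two walks part at [b], so a common end closes a cycle of length at most [2 * (s + t + 1)].
    At [s = t = L] this is [4 * L + 2]. *)
Lemma lam_disjoint_factor s t b i j k : incident inc b i -> incident inc b j -> i <> j ->
  (2 * (s + t + 1) < g)%N -> lam s i (Some b) k -> lam t j (Some b) k -> False.
Proof.
move=> bi bj ij sg /(lam_walk bi)[x [nx x0 x1 xk]] /(lam_walk bj)[y [ny y0 y1 yk]].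
apply: (no_short_cycle sg).
have -> : (2 * (s + t + 1) = (2 * s).+1 + (2 * t).+1)%N by lia.
by apply: (nbwalk_two nx ny); rewrite ?x0 ?y0 ?x1 ?y1 ?xk ?yk// => -[].
Qed.

Lemma lam_disjoint_variable s t b c i j j' k : incident inc b i -> incident inc c i ->
  b <> c -> incident inc b j -> incident inc c j' -> i <> j -> i <> j' ->
  (2 * (s + t + 2) < g)%N -> lam s j (Some b) k -> lam t j' (Some c) k -> False.
Proof.
move=> bi ci bc bj cj ij ij' sg /(lam_walk bj)[x [nx x0 x1 xk]] /(lam_walk cj)[y [ny y0 y1 yk]].
have nx' : nbwalk (consw (inl i) x) (2 * s).+2.
  by apply: nbwalk_cons => //; [rewrite x0|rewrite x1 => _ -[]].
have ny' : nbwalk (consw (inl i) y) (2 * t).+2.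
  by apply: nbwalk_cons => //; [rewrite y0|rewrite y1 => _ -[]].
apply: (no_short_cycle sg).
have -> : (2 * (s + t + 2) = (2 * s).+2 + (2 * t).+2)%N by lia.
by apply: (nbwalk_two nx' ny'); rewrite //= ?x0 ?y0 ?xk ?yk// => -[].
Qed.

(** Depth is well defined: both walks to [k] are followed while they agree. They part at a factor or
    at a variable, closing a short cycle, or the shorter one ends and the rest of the longer is
    closed. *)
Lemma lam_level_unique s t i o k : (t < s)%N -> (2 * (s + t) < g)%N ->
  lam s i o k -> lam t i o k -> False.
Proof.
elim: t s i o => [|t ih] [//|s] i o ts sg.
  move=> /= [b [kap [bi bo ne h]]] ik; rewrite -ik in h.
  have [x [nx x0 x1 xk]] := lam_walk (incident_inc b kap) h.
  apply: (no_short_cycle sg); apply: (@nbwalk_cycle (consw (inl i) x)).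
  - rewrite (_ : 2 * (s.+1 + 0) = (2 * s).+2)%N; last by lia.
    by apply: nbwalk_cons => //; [rewrite x0|rewrite x1 => _ -[e]; move: ne; rewrite e eqxx].
  - by lia.
  - by rewrite (_ : 2 * (s.+1 + 0) = (2 * s).+2)%N ?xk//; lia.
move=> [b [kap [bi bo ne h]]] [b' [kap' [bi' bo' ne' h']]].
have [bb|bb] := eqVneq b b'; last first.
  apply: (@lam_disjoint_variable s t b b' i (inc b kap) (inc b' kap')) h h' => //;
    try exact: incident_inc; try (exact/eqP); try lia.
  - by apply/nesym/eqP.
  - by apply/nesym/eqP.
rewrite -{}bb in bi' bo' ne' h'.
have [kk|kk] := eqVneq (inc b kap) (inc b kap').
  by rewrite -kk in h'; apply: (ih s _ _ _ _ h h'); lia.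
apply: (lam_disjoint_factor (incident_inc b kap) (incident_inc b kap') _ _ h h').
  exact/eqP.
by lia.
Qed.

End NonBacktracking.

(** * The recursion *)

Section Recursion.
Context {R : realType} {r : nat} (f : {ffun 'I_r -> bool} -> bool)
  {V E : finType} (inc : E -> 'I_r -> V) (d : nat)
  (Fm Fn : forall l : nat, l.-tuple R -> R).
Implicit Types (z : V -> R).

(** Level [s] is read from the list stopped at [s], so no outer length enters; [nth_wseq] gives
    agreement with longer lists. The initial field [z] is an argument, to which flips can be
    applied. *)
Definition wm z s i a : R := nthm (wseq f inc d Fm z s).1 s i a.
Definition um z s i a : R := wm z s i a - wm z s.-1 i a.
Definition am z s i a : R := Fm [tuple um z k.+1 i a | k < s].
Definition zm z l i a : R := z i + \sum_(s < l) am z s i a * um z s.+1 i a.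

Definition wn z s i : R := nthn (wseq f inc d Fm z s).2 s i.
Definition un z s i : R := wn z s i - wn z s.-1 i.
Definition an z s i : R := Fn [tuple un z k.+1 i | k < s].
Definition zn z l i : R := z i + \sum_(s < l) an z s i * un z s.+1 i.

Lemma size_wseq z l :
  size (wseq f inc d Fm z l).1 = l.+1 /\ size (wseq f inc d Fm z l).2 = l.+1.
Proof.
elim: l => //= l; case: (wseq _ _ _ _ _ l) => a b /= [ea eb].
by rewrite !size_rcons ea eb.
Qed.

Lemma nth_wseq z l s : (s <= l)%N ->
  nthm (wseq f inc d Fm z l).1 s = wm z s /\ nthn (wseq f inc d Fm z l).2 s = wn z s.
Proof.
elim: l => [|l ih]; first by case: s.
rewrite leq_eqVlt => /predU1P[->//|]; rewrite ltnS => sl.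
have [<- <-] := ih sl; have [] := size_wseq z l; rewrite /=.
case: (wseq _ _ _ _ _ l) => a b /= ea eb.
by rewrite /nthm /nthn !nth_rcons ea eb ltnS sl.
Qed.

Lemma umsg_wseq z l s i a : (s <= l)%N -> umsg (wseq f inc d Fm z l).1 s i a = um z s i a.
Proof.
by move=> sl; rewrite /umsg (nth_wseq z sl).1 (nth_wseq z (leq_trans (leq_pred s) sl)).1.
Qed.

Lemma Amsg_wseq z l s i a : (s <= l)%N -> Amsg Fm (wseq f inc d Fm z l).1 s i a = am z s i a.
Proof.
move=> sl; rewrite /Amsg /am; congr (Fm _); apply: eq_from_tnth => k.
by rewrite !tnth_mktuple umsg_wseq// (leq_trans (ltn_ord k)).
Qed.

Lemma zmsg_wseq z l s i a : (s <= l)%N -> zmsg Fm z (wseq f inc d Fm z l).1 s i a = zm z s i a.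
Proof.
move=> sl; rewrite /zmsg /zm; congr (_ + _); apply: eq_bigr => q _.
have qs := leq_trans (ltn_ord q) sl.
by rewrite umsg_wseq// Amsg_wseq// ltnW.
Qed.

Lemma A_msgE z l s i a : (s <= l)%N -> A_msg f inc d Fm z l s i a = am z s i a.
Proof. exact: Amsg_wseq. Qed.

Lemma u_nodeE z l s i : (s <= l)%N -> u_node f inc d Fm z l s i = un z s i.
Proof.
by move=> sl; rewrite /u_node /unode (nth_wseq z sl).2 (nth_wseq z (leq_trans (leq_pred s) sl)).2.
Qed.

Lemma A_nodeE z l s i : (s <= l)%N -> A_node f inc d Fm Fn z l s i = an z s i.
Proof.
move=> sl; rewrite /A_node /Anode /an; congr (Fn _); apply: eq_from_tnth => k.
by rewrite !tnth_mktuple -(@u_nodeE z l)// (leq_trans (ltn_ord k)).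
Qed.

Lemma z_nodeE z l i : z_node f inc d Fm Fn z l l i = zn z l i.
Proof.
rewrite /z_node /znode /zn; congr (_ + _); apply: eq_bigr => q _.
by rewrite -(A_nodeE _ _ (ltnW (ltn_ord q))) -(u_nodeE _ _ (ltn_ord q)).
Qed.

Lemma wmS z l i a : wm z l.+1 i a = (Num.sqrt (d%:R - 1))^-1 *
  \sum_(b | incident inc b i && (b != a)) Dfac f inc b i (fun k => zm z l (inc b k) b).
Proof.
rewrite /wm [wseq _ _ _ _ _ l.+1]/=; have h j b := @zmsg_wseq z l l j b (leqnn l).
have [] := size_wseq z l; move: h; case: (wseq _ _ _ _ _ l) => p q h ep eq.
rewrite [(_, _).1]/= in h ep *.
rewrite /nthm nth_rcons ep ltnn eqxx; congr (_ * _); apply: eq_bigr => b _.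
by congr Dfac; apply/funext => k.
Qed.

Lemma wnS z l i : wn z l.+1 i = (Num.sqrt d%:R)^-1 *
  \sum_(b | incident inc b i) Dfac f inc b i (fun k => zm z l (inc b k) b).
Proof.
rewrite /wn [wseq _ _ _ _ _ l.+1]/=; have h j b := @zmsg_wseq z l l j b (leqnn l).
have [] := size_wseq z l; move: h; case: (wseq _ _ _ _ _ l) => p q h ep eq.
rewrite [(_, _).2]/= in eq *; rewrite [(_, _).1]/= in h *.
rewrite /nthn nth_rcons eq ltnn eqxx; congr (_ * _); apply: eq_bigr => b _.
by congr Dfac; apply/funext => k.
Qed.

Hypothesis fhat1 : forall S : {set 'I_r}, #|S| = 1%N -> fhat (R:=R) f S = 0.
Hypothesis inc_inj : forall b, injective (inc b).

Lemma Dfac_inc b k (x : 'I_r -> R) : Dfac f inc b (inc b k) x = fder f k x.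
Proof.
rewrite /Dfac; case: pickP => [k' /eqP /inc_inj -> //|/(_ k)].
by rewrite eqxx.
Qed.

Lemma incidentP b i : reflect (exists k, inc b k = i) (incident inc b i).
Proof.
by apply: (iffP existsP) => -[k h]; exists k; exact/eqP.
Qed.

(** Only the singleton of [k] leaves an empty product, and its coefficient vanishes. *)
Lemma fder0 k : fder f k (fun=> 0 : R) = 0.
Proof.
rewrite /fder big1// => S kS.
have [SE|[j jS]] := set_0Vmem (S :\ k)%SET.
  by rewrite fhat1 ?mul0r// (cardsD1 k) kS SE cards0.
by rewrite (bigD1 j)//= mul0r mulr0.
Qed.

(* [zp z s] is the message [z^(s-1)], extended by [0] below [s = 1]; this
   convention makes [w^0 = 0] an instance of the recursion because the degree
   one Fourier coefficients vanish. *)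
Definition zp z s i a : R := if s is s'.+1 then zm z s' i a else 0.
Definition yp z s b i : R := Dfac f inc b i (fun k => zp z s (inc b k) b).
(** The unnormalized sum behind [w]: [Some a] gives the message towards [a], [None] the node
    quantity, so both share one set of lemmas. *)
Definition ys z s (o : option E) i : R :=
  \sum_(b | incident inc b i && (Some b != o)) yp z s b i.

(** Coefficient [ae] and increment [ee] of [zp] at level [s], shifted so that level 0 contributes
    [1 * z i]. The coefficient sees depths below [s] only. *)
Definition ae z s i a : R := if s is s'.+1 then am z s' i a else 1.
Definition ee z s i a : R := if s is _.+1 then um z s i a else z i.

Lemma zpS z s i a : zp z s.+1 i a = zp z s i a + ae z s i a * ee z s i a.
Proof.
case: s => [|s] /=; first by rewrite /zm big_ord0 addr0 add0r mul1r.
by rewrite /zm big_ord_recr /= addrA.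
Qed.

Lemma yp0 z b i : yp z 0 b i = 0.
Proof. by rewrite /yp /Dfac /=; case: pickP => // k _; exact: fder0. Qed.

Lemma ys0 z o i : ys z 0 o i = 0.
Proof. by rewrite /ys big1// => b _; exact: yp0. Qed.

Lemma wm_ys z s i a : wm z s i a = (Num.sqrt (d%:R - 1))^-1 * ys z s (Some a) i.
Proof. by case: s => [|s]; [rewrite ys0 mulr0|rewrite wmS]. Qed.

Lemma wn_ys z s i : wn z s i = (Num.sqrt d%:R)^-1 * ys z s None i.
Proof.
case: s => [|s]; first by rewrite ys0 mulr0.
by rewrite wnS; congr (_ * _); apply: eq_bigl => b; rewrite andbT.
Qed.

Lemma um_ys z s i a : um z s.+1 i a =
  (Num.sqrt (d%:R - 1))^-1 * (ys z s.+1 (Some a) i - ys z s (Some a) i).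
Proof. by rewrite /um /= !wm_ys mulrBr. Qed.

Lemma un_ys z s i : un z s.+1 i = (Num.sqrt d%:R)^-1 * (ys z s.+1 None i - ys z s None i).
Proof. by rewrite /un /= !wn_ys mulrBr. Qed.

Lemma ysB z s o i : ys z s.+1 o i - ys z s o i =
  \sum_(b | incident inc b i && (Some b != o)) (yp z s.+1 b i - yp z s b i).
Proof. by rewrite /ys sumrB. Qed.

Lemma Dfac_ext b i (x x' : 'I_r -> R) : (forall k, inc b k != i -> x k = x' k) ->
  Dfac f inc b i x = Dfac f inc b i x'.
Proof.
rewrite /Dfac; case: pickP => // k /eqP <- h; rewrite /fder.
apply: eq_bigr => S _; congr (_ * _); apply: eq_bigr => j; rewrite in_setD1 => /andP[jk _].
by apply: h; rewrite (inj_eq (@inc_inj b)).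
Qed.

Definition agree (z z' : V -> R) (L : V -> Prop) := forall k, L k -> z k = z' k.

Lemma yp_dep_aux z z' s b i :
  (forall j, inc b j != i -> zp z s (inc b j) b = zp z' s (inc b j) b) ->
  yp z s b i = yp z' s b i.
Proof. by move=> h; apply: Dfac_ext. Qed.

(** Each unrolling of the recursion passes from [i] to the other entries of the factors [b != a] at
    [i], which are its children in the tree. *)
Lemma zp_dep z z' s i a :
  (forall t, (t < s)%N -> agree z z' (lam inc t i (Some a))) ->
  zp z s i a = zp z' s i a.
Proof.
elim/ltn_ind: s i a => -[//|s] ih i a h /=.
rewrite /zm; congr (_ + _); first by apply: (h 0%N).
have hu q : (q < s)%N -> um z q.+1 i a = um z' q.+1 i a.
  move=> qs; rewrite !um_ys !ysB; congr (_ * _); apply: eq_bigr => b /andP[bi ba].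
  have hy q' : (q' <= q.+1)%N -> yp z q' b i = yp z' q' b i.
    move=> qq; apply: yp_dep_aux => j ji; apply: ih; first by rewrite ltnS (leq_trans qq).
    move=> t tq k lk; apply: (h t.+1).
      by rewrite ltnS (leq_trans tq)// (leq_trans qq).
    by exists b, j.
  by rewrite !hy.
apply: eq_bigr => q _; rewrite hu//; congr (_ * _).
rewrite /am; congr (Fm _); apply: eq_from_tnth => k.
by rewrite !tnth_mktuple hu// (ltn_trans (ltn_ord k)).
Qed.

Lemma yp_dep z z' s b i :
  (forall t j, (t < s)%N -> inc b j != i -> agree z z' (lam inc t (inc b j) (Some b))) ->
  yp z s b i = yp z' s b i.
Proof. by move=> h; apply: yp_dep_aux => j ji; apply: zp_dep => t ts; exact: h. Qed.

Lemma ys_dep z z' s o i :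
  (forall t, (t < s)%N -> agree z z' (lam inc t.+1 i o)) -> ys z s o i = ys z' s o i.
Proof.
move=> h; apply: eq_bigr => b /andP[bi bo]; apply: yp_dep => t j ts ji k lk.
by apply: (h t ts); exists b, j.
Qed.

Lemma um_dep z z' s i a :
  (forall t, (t <= s)%N -> agree z z' (lam inc t.+1 i (Some a))) ->
  um z s.+1 i a = um z' s.+1 i a.
Proof.
by move=> h; rewrite !um_ys; congr (_ * (_ - _)); apply: ys_dep => t ts; apply: h => //; rewrite ltnW.
Qed.

Lemma un_dep z z' s i :
  (forall t, (t <= s)%N -> agree z z' (lam inc t.+1 i None)) ->
  un z s.+1 i = un z' s.+1 i.
Proof.
by move=> h; rewrite !un_ys; congr (_ * (_ - _)); apply: ys_dep => t ts; apply: h => //; rewrite ltnW.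
Qed.

Lemma am_dep z z' s i a :
  (forall t, (t < s)%N -> agree z z' (lam inc t.+1 i (Some a))) ->
  am z s i a = am z' s i a.
Proof.
move=> h; rewrite /am; congr (Fm _); apply: eq_from_tnth => k.
rewrite !tnth_mktuple; apply: um_dep => t tk; apply: h.
exact: leq_ltn_trans tk (ltn_ord k).
Qed.

Lemma an_dep z z' s i :
  (forall t, (t < s)%N -> agree z z' (lam inc t.+1 i None)) ->
  an z s i = an z' s i.
Proof.
move=> h; rewrite /an; congr (Fn _); apply: eq_from_tnth => k.
rewrite !tnth_mktuple; apply: un_dep => t tk; apply: h.
exact: leq_ltn_trans tk (ltn_ord k).
Qed.

Lemma agree_flip k z (L : V -> Prop) : ~ L k -> agree (flip k z) z L.
Proof. by move=> nL j Lj; rewrite flipE//; apply/eqP => jk; rewrite jk in Lj. Qed.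

End Recursion.

(** * Orthogonality *)

Section Orthogonality.
Context {R : realType} {r : nat} (f : {ffun 'I_r -> bool} -> bool)
  {V E : finType} (inc : E -> 'I_r -> V) (d : nat)
  (Fm Fn : forall l : nat, l.-tuple R -> R) (L : nat) (K : R).
Hypothesis fhat1 : forall S : {set 'I_r}, #|S| = 1%N -> fhat (R:=R) f S = 0.
Hypothesis inc_inj : forall b, injective (inc b).
Hypothesis girth : fg_girth_ge inc (4 * L + 4).
Hypothesis mFm : forall l, (l < L)%N -> measurable_fun setT (@Fm l).
Hypothesis mFn : forall l, (l < L)%N -> measurable_fun setT (@Fn l).
Hypothesis Fm_bdd : forall l, (l < L)%N -> forall t, `|@Fm l t| <= K.
Hypothesis Fn_bdd : forall l, (l < L)%N -> forall t, `|@Fn l t| <= K.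

Local Notation Om := (@cspace V R).
Variable mu : probability Om R.
Hypothesis flip_inv : flip_invariant mu.
Hypothesis nice_coord : forall i, nice mu (fun z : Om => z i).

Local Notation zp := (zp f inc d Fm).
Local Notation yp := (yp f inc d Fm).
Local Notation ys := (ys f inc d Fm).
Local Notation ae := (ae f inc d Fm).
Local Notation ee := (ee f inc d Fm).
Local Notation um := (um f inc d Fm).
Local Notation am := (am f inc d Fm).
Local Notation un := (un f inc d Fm).
Local Notation an := (an f inc d Fm Fn).
Local Notation lam := (lam inc).

Lemma nice_fder k (X : 'I_r -> Om -> R) : (forall j, nice mu (X j)) ->
  nice mu (fun z => fder f k (fun j => X j z)).
Proof.
move=> nX; apply: nice_sum => S _; apply: niceM; first exact: nice_cst.
by apply: nice_prod.
Qed.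

Lemma nice_yp_aux s b i : (forall j, nice mu (fun z : Om => zp z s (inc b j) b)) ->
  nice mu (fun z : Om => yp z s b i).
Proof.
move=> nz; rewrite /yp /Dfac; case: pickP => [k _|_]; last exact: nice_cst.
exact: nice_fder.
Qed.

Lemma measurable_mktuple s (X : 'I_s -> Om -> R) :
  (forall k, measurable_fun setT (X k)) ->
  measurable_fun setT (fun z => [tuple X k z | k < s]).
Proof.
move=> mX; apply/measurable_fun_tnthP => k.
by rewrite (_ : _ \o _ = X k)//; apply/funext => z /=; rewrite tnth_mktuple.
Qed.

Lemma nice_meas X : nice mu X -> measurable_fun setT X.
Proof. by case=> B /mom_meas. Qed.

Lemma nice_um_aux s i a : (forall q b, (q <= s.+1)%N -> nice mu (fun z : Om => yp z q b i)) ->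
  nice mu (fun z : Om => um z s.+1 i a).
Proof.
move=> ny; rewrite (_ : (fun z : Om => um z s.+1 i a) = fun z : Om =>
  (Num.sqrt (d%:R - 1))^-1 * (ys z s.+1 (Some a) i - ys z s (Some a) i)); last first.
  by apply/funext => z; exact: um_ys.
apply: niceM; first exact: nice_cst.
by apply: niceB; apply: nice_sum => b _; apply: ny.
Qed.

Lemma nice_am_aux s i a : (s < L)%N ->
  (forall q, (q < s)%N -> nice mu (fun z : Om => um z q.+1 i a)) ->
  nice mu (fun z : Om => am z s i a).
Proof.
move=> sL nu; exists (cstB K); apply: mom_bdd => [|z]; last exact: Fm_bdd.
apply: (measurableT_comp (mFm sL)); apply: measurable_mktuple => k.
by apply: nice_meas; apply: nu.
Qed.

Lemma nice_zp s i a : (s <= L.+1)%N -> nice mu (fun z : Om => zp z s i a).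
Proof.
elim/ltn_ind: s i a => -[|s] ih i a sL; first exact: nice_cst.
have nu q j c : (q < s)%N -> nice mu (fun z : Om => um z q.+1 j c).
  move=> qs; apply: nice_um_aux => q' b qq; apply: nice_yp_aux => k.
  apply: ih; first by rewrite ltnS (leq_trans qq).
  by rewrite (leq_trans qq)// (leq_trans qs)// ltnW.
apply: niceD => //; apply: nice_sum => q _; apply: niceM; last exact: nu.
apply: nice_am_aux; first by rewrite (leq_trans (ltn_ord q)).
by move=> q' qq; apply: nu; rewrite (ltn_trans qq).
Qed.

Lemma nice_yp s b i : (s <= L.+1)%N -> nice mu (fun z : Om => yp z s b i).
Proof. by move=> sL; apply: nice_yp_aux => j; exact: nice_zp. Qed.

Lemma nice_ys s o i : (s <= L.+1)%N -> nice mu (fun z : Om => ys z s o i).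
Proof. by move=> sL; apply: nice_sum => b _; exact: nice_yp. Qed.

Lemma nice_um s i a : (s <= L)%N -> nice mu (fun z : Om => um z s.+1 i a).
Proof. by move=> sL; apply: nice_um_aux => q b qs; apply: nice_yp; rewrite (leq_trans qs). Qed.

Lemma nice_am s i a : (s < L)%N -> nice mu (fun z : Om => am z s i a).
Proof.
move=> sL; apply: (nice_am_aux sL) => q qs.
by apply: nice_um; rewrite ltnW// (ltn_trans qs).
Qed.

Lemma nice_un s i : (s <= L)%N -> nice mu (fun z : Om => un z s.+1 i).
Proof.
move=> sL; rewrite (_ : (fun z : Om => un z s.+1 i) = fun z : Om =>
  (Num.sqrt d%:R)^-1 * (ys z s.+1 None i - ys z s None i)); last first.
  by apply/funext => z; exact: un_ys.
apply: niceM; first exact: nice_cst.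
by apply: niceB; apply: nice_ys => //; rewrite ltnW.
Qed.

Lemma measurable_an s i : (s < L)%N -> measurable_fun setT (fun z : Om => an z s i).
Proof.
move=> sL; apply: (measurableT_comp (mFn sL)); apply: measurable_mktuple => k.
by apply: nice_meas; apply: nice_un; rewrite ltnW// (ltn_trans (ltn_ord k)).
Qed.

Lemma nice_an s i : (s < L)%N -> nice mu (fun z : Om => an z s i).
Proof.
move=> sL; exists (cstB K); apply: mom_bdd => [|z]; last exact: Fn_bdd.
exact: measurable_an.
Qed.

Lemma nice_ae s i a : (s <= L)%N -> nice mu (fun z : Om => ae z s i a).
Proof. by case: s => [|s] sL; [exact: nice_cst|exact: nice_am]. Qed.

Lemma nice_ee s i a : (s <= L)%N -> nice mu (fun z : Om => ee z s i a).
Proof. by case: s => [|s] sL; [exact: nice_coord|apply: nice_um; exact: ltnW]. Qed.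

(** Invariance under the sign change of [z k], exactly what [Ex_coord_mul0] asks of the other
    factor. *)
Definition blind (G : (V -> R) -> R) k := forall z, G (flip k z) = G z.

Lemma blindM G H k : blind G k -> blind H k -> blind (fun z => G z * H z) k.
Proof. by move=> hG hH z; rewrite hG hH. Qed.

Lemma blind_prod (I : eqType) (q : seq I) (G : I -> (V -> R) -> R) k :
  (forall i, i \in q -> blind (G i) k) -> blind (fun z => \prod_(i <- q) G i z) k.
Proof. by move=> h z; apply: eq_big_seq => i iq; exact: h. Qed.

Lemma blind_zp s i a k : (forall t, (t < s)%N -> ~ lam t i (Some a) k) ->
  blind (fun z => zp z s i a) k.
Proof. by move=> h z; apply: zp_dep => // t ts; apply: agree_flip; exact: h. Qed.

Lemma blind_am s i a k : (forall t, (t < s)%N -> ~ lam t.+1 i (Some a) k) ->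
  blind (fun z => am z s i a) k.
Proof. by move=> h z; apply: am_dep => // t ts; apply: agree_flip; exact: h. Qed.

Lemma blind_um s i a k : (forall t, (t <= s)%N -> ~ lam t.+1 i (Some a) k) ->
  blind (fun z => um z s.+1 i a) k.
Proof. by move=> h z; apply: um_dep => // t ts; apply: agree_flip; exact: h. Qed.

Lemma blind_an s i k : (forall t, (t < s)%N -> ~ lam t.+1 i None k) ->
  blind (fun z => an z s i) k.
Proof. by move=> h z; apply: an_dep => // t ts; apply: agree_flip; exact: h. Qed.

Lemma blind_un s i k : (forall t, (t <= s)%N -> ~ lam t.+1 i None k) ->
  blind (fun z => un z s.+1 i) k.
Proof. by move=> h z; apply: un_dep => // t ts; apply: agree_flip; exact: h. Qed.

Lemma blind_ys s o i k : (forall t, (t < s)%N -> ~ lam t.+1 i o k) ->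
  blind (fun z => ys z s o i) k.
Proof. by move=> h z; apply: ys_dep => // t ts; apply: agree_flip; exact: h. Qed.

Lemma blind_yp s b i k :
  (forall t j, (t < s)%N -> inc b j != i -> ~ lam t (inc b j) (Some b) k) ->
  blind (fun z => yp z s b i) k.
Proof. by move=> h z; apply: yp_dep => // t j ts ji; apply: agree_flip; exact: h. Qed.

Lemma blind_ae s i a k : (forall t, (t < s)%N -> ~ lam t i (Some a) k) ->
  blind (fun z => ae z s i a) k.
Proof.
by case: s => [|s] h //; apply: blind_am => t ts; apply: (h t.+1).
Qed.

Lemma inc_neq b j j' : j != j' -> inc b j <> inc b j'.
Proof. by move=> /eqP jj /inc_inj. Qed.

(** Blindness is required only at depth exactly [s], which leaves [G] free to contain coefficients
    and increments of lower levels. *)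
Definition msg_orth s := forall i a (G : Om -> R), incident inc a i -> nice mu G ->
  (forall k, lam s i (Some a) k -> blind G k) -> Ex mu (fun z : Om => ee z s i a * G z) = 0.

(** The factors are updated one at a time. Each update produces one [ee] of level [s], multiplied by
    its coefficient (smaller depths), by the other messages into [b] (disjoint branches) and by [G];
    all of these are blind to the depth [s] of its branch. *)
Lemma telescope_orth s b (q : seq 'I_r) (G : Om -> R) : (s <= L)%N -> msg_orth s ->
  uniq q -> nice mu G ->
  (forall j k, j \in q -> lam s (inc b j) (Some b) k -> blind G k) ->
  Ex mu (fun z : Om => (\prod_(j <- q) zp z s.+1 (inc b j) b -
                   \prod_(j <- q) zp z s (inc b j) b) * G z) = 0.
Proof.
move=> sL M; elim: q G => [|j q ih] G /=.
  move=> _ _ _; rewrite (_ : (fun _ => _) = fun=> 0) ?Ex_cst//.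
  by apply/funext => z; rewrite !big_nil subrr mul0r.
move=> /andP[jq uq] nG bG.
pose G1 (z : Om) := ae z s (inc b j) b * ((\prod_(j <- q) zp z s.+1 (inc b j) b) * G z).
pose G2 (z : Om) := zp z s (inc b j) b * G z.
have nP s' : (s' <= L.+1)%N -> nice mu (fun z : Om => \prod_(j <- q) zp z s' (inc b j) b).
  by move=> s'L; apply: nice_prod => l _; exact: nice_zp.
have nG1 : nice mu G1.
  by apply: niceM; [exact: nice_ae|apply: niceM => //; exact: nP].
have nG2 : nice mu G2 by apply: niceM => //; apply: nice_zp; rewrite ltnW.
have -> : (fun z : Om => (\prod_(j0 <- j :: q) zp z s.+1 (inc b j0) b -
     \prod_(j0 <- j :: q) zp z s (inc b j0) b) * G z) =
  (fun z : Om => ee z s (inc b j) b * G1 z +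
     (\prod_(j <- q) zp z s.+1 (inc b j) b - \prod_(j <- q) zp z s (inc b j) b) * G2 z).
  apply/funext => z; rewrite !big_cons /G1 /G2 zpS; ring.
have nej l : l \in q -> l != j by move=> lq; apply: contraNneq jq => <-.
rewrite ExD; first last.
- apply: nice_integ; apply: niceM => //; apply: niceB; apply: nP => //.
  by rewrite ltnW.
- by apply: nice_integ; apply: niceM => //; exact: nice_ee.
rewrite M//; last first.
  move=> k lk; apply: blindM; [|apply: blindM].
  - apply: blind_ae => t ts lt; apply: (lam_level_unique girth ts _ lk lt); lia.
  - apply: blind_prod => l lq; apply: blind_zp => t ts lt.
    apply: (lam_disjoint_factor girth (incident_inc inc b j) (incident_inc inc b l)
       _ _ lk lt); last by lia.
    by apply: inc_neq; rewrite eq_sym nej.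
  - by apply: (bG j) => //; rewrite mem_head.
- exact: incident_inc.
rewrite add0r; apply: ih => // l k lq lk; apply: blindM.
  apply: blind_zp => t ts lt.
  apply: (lam_disjoint_factor girth (incident_inc inc b l) (incident_inc inc b j)
       _ _ lk lt); last by lia.
  by apply: inc_neq; exact: nej.
by apply: (bG l) => //; rewrite inE lq orbT.
Qed.

Lemma yp_orth_aux s b i (G : Om -> R) : (s <= L)%N -> msg_orth s ->
  incident inc b i -> nice mu G ->
  (forall j k, inc b j != i -> lam s (inc b j) (Some b) k -> blind G k) ->
  Ex mu (fun z : Om => (yp z s.+1 b i - yp z s b i) * G z) = 0.
Proof.
move=> sL M /(incidentP inc) [kap <-] nG bG.
have -> : (fun z : Om => (yp z s.+1 b (inc b kap) - yp z s b (inc b kap)) * G z) =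
  (fun z : Om => \sum_(S : {set 'I_r} | kap \in S) fhat f S *
     ((\prod_(j <- enum (S :\ kap)%SET) zp z s.+1 (inc b j) b -
       \prod_(j <- enum (S :\ kap)%SET) zp z s (inc b j) b) * G z)).
  apply/funext => z; rewrite /yp !Dfac_inc// /fder -sumrB mulr_suml.
  by apply: eq_bigr => S _; rewrite !big_enum/=; ring.
have nS (S : {set 'I_r}) : nice mu (fun z : Om =>
   (\prod_(j <- enum (S :\ kap)%SET) zp z s.+1 (inc b j) b -
       \prod_(j <- enum (S :\ kap)%SET) zp z s (inc b j) b) * G z).
  by apply: niceM => //; apply: niceB; apply: nice_prod => j _; apply: nice_zp => //; rewrite ltnW.
rewrite Ex_sum => [|S kS]; last by apply: integZ; exact: nice_integ.
apply: big1 => S kS; rewrite ExZ; last exact: nice_integ.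
rewrite telescope_orth ?mulr0// ?enum_uniq// => j k.
rewrite mem_enum in_setD1 => /andP[jk _]; apply: bG.
by apply/eqP; exact: inc_neq.
Qed.

(** Depth [s] below a child of [i] is depth [s.+1] below [i], so the hypothesis on [G] passes to
    every factor in the sum defining [u]. *)
Lemma msg_orthP s : (s <= L)%N -> msg_orth s.
Proof.
elim: s => [|s ih] sL i a G ai nG bG.
  apply: Ex_coord_mul0 => //.
    by apply: nice_integ; exact: niceM.
  by apply: bG.
have M := ih (ltnW sL).
have -> : (fun z : Om => ee z s.+1 i a * G z) =
  (fun z : Om => (Num.sqrt (d%:R - 1))^-1 *
     \sum_(b | incident inc b i && (Some b != Some a)) (yp z s.+1 b i - yp z s b i) * G z).
  by apply/funext => z; rewrite [ee _ _ _ _]um_ys// ysB -mulrA mulr_suml.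
have nY b : nice mu (fun z : Om => (yp z s.+1 b i - yp z s b i) * G z).
  by apply: niceM => //; apply: niceB; apply: nice_yp => //; rewrite ltnW// ltnW.
rewrite ExZ; last by apply: integ_sum => b _; exact: nice_integ.
rewrite Ex_sum => [|b _]; last exact: nice_integ.
rewrite big1 ?mulr0// => b /andP[bi ba].
apply: yp_orth_aux => //; first exact: ltnW.
by move=> j k ji lk; apply: bG; exists b, j.
Qed.

Lemma yp_orth s b i (G : Om -> R) : (s <= L)%N -> incident inc b i -> nice mu G ->
  (forall j k, inc b j != i -> lam s (inc b j) (Some b) k -> blind G k) ->
  Ex mu (fun z : Om => (yp z s.+1 b i - yp z s b i) * G z) = 0.
Proof. by move=> sL; apply: yp_orth_aux => //; exact: msg_orthP. Qed.

Lemma yp_mean0 s b i (G : Om -> R) : (s <= L.+1)%N -> incident inc b i -> nice mu G ->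
  (forall t j k, (t < s)%N -> inc b j != i -> lam t (inc b j) (Some b) k -> blind G k) ->
  Ex mu (fun z : Om => yp z s b i * G z) = 0.
Proof.
move=> sL bi nG; elim: s sL => [|s ih] sL bG.
  rewrite (_ : (fun _ => _) = fun=> 0) ?Ex_cst//.
  by apply/funext => z; rewrite yp0 ?mul0r.
have -> : (fun z : Om => yp z s.+1 b i * G z) =
   (fun z : Om => (yp z s.+1 b i - yp z s b i) * G z + yp z s b i * G z).
  by apply/funext => z; ring.
have sL' : (s <= L.+1)%N by rewrite ltnW.
rewrite ExD; first last.
- by apply: nice_integ; apply: niceM => //; exact: nice_yp.
- by apply: nice_integ; apply: niceM => //; apply: niceB; exact: nice_yp.
rewrite yp_orth// ?ih ?addr0//.
  by move=> t j k ts; apply: bG; rewrite ltnS ltnW.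
by move=> j k; apply: bG.
Qed.

(** A nonempty product starts at zero for [s = 0], by the convention for [zp], and every later
    change has mean zero by [telescope_orth] with [G = 1]. *)
Lemma prod_zp_mean0 s b (q : seq 'I_r) : (s <= L.+1)%N -> uniq q -> (0 < size q)%N ->
  Ex mu (fun z : Om => \prod_(j <- q) zp z s (inc b j) b) = 0.
Proof.
move=> + uq q0; elim: s => [|s ih] sL.
  rewrite (_ : (fun _ => _) = fun=> 0) ?Ex_cst//.
  by apply/funext => z; case: q q0 {uq} => // j q _; rewrite big_cons mul0r.
have nP s' : (s' <= L.+1)%N -> nice mu (fun z : Om => \prod_(j <- q) zp z s' (inc b j) b).
  by move=> s'L; apply: nice_prod => l _; exact: nice_zp.
have sL' : (s <= L.+1)%N by rewrite ltnW.
have -> : (fun z : Om => \prod_(j <- q) zp z s.+1 (inc b j) b) =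
  (fun z : Om => (\prod_(j <- q) zp z s.+1 (inc b j) b -
       \prod_(j <- q) zp z s (inc b j) b) * 1 + \prod_(j <- q) zp z s (inc b j) b).
  by apply/funext => z; ring.
rewrite ExD; first last.
- by apply: nice_integ; exact: nP.
- apply: nice_integ; apply: niceM; last exact: nice_cst.
  by apply: niceB; exact: nP.
rewrite ih// telescope_orth ?addr0//; [exact: msg_orthP|exact: nice_cst].
Qed.

(** Let [p] be the larger of [s] and [t]. The increment of level [p] is tested at depth [p.+1],
    while the remaining factors stop at depth [p]. The [wlog] brings both orders of [s] and [t] to
    this common shape. *)
Lemma node_orth s t i : (s < L)%N -> (t <= L)%N -> s <> t ->
  Ex mu (fun z : Om => an z s i * un z s.+1 i * (ys z t.+1 None i - ys z t None i)) = 0.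
Proof.
move=> sL tL st.
wlog [p [G [pL nG bG ->]]] : / exists p (G : Om -> R), [/\ (p <= L)%N, nice mu G,
   (forall k, lam p.+1 i None k -> blind G k) &
   (fun z : Om => an z s i * un z s.+1 i * (ys z t.+1 None i - ys z t None i)) =
   (fun z : Om => (ys z p.+1 None i - ys z p None i) * G z)].
  apply; case: (ltngtP s t) => [lst|lts|//].
  - exists t, (fun z : Om => an z s i * un z s.+1 i); split=> //.
    + by apply: niceM; [exact: nice_an|apply: nice_un; exact: ltnW].
    + move=> k lk; apply: blindM.
        by apply: blind_an => u us lu; apply: (lam_level_unique girth _ _ lk lu); lia.
      by apply: blind_un => u us lu; apply: (lam_level_unique girth _ _ lk lu); lia.
    + by apply/funext => z; rewrite mulrC.
  - exists s, (fun z : Om => (Num.sqrt d%:R)^-1 *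
       (an z s i * (ys z t.+1 None i - ys z t None i))); split=> //.
    + exact: ltnW.
    + apply: niceM; first exact: nice_cst.
      apply: niceM; first exact: nice_an.
      by apply: niceB; apply: nice_ys; lia.
    + move=> k lk; apply: blindM => //; apply: blindM.
        by apply: blind_an => u us lu; apply: (lam_level_unique girth _ _ lk lu); lia.
      have by' q : (q <= s)%N -> blind (fun z => ys z q None i) k.
        move=> qs; apply: blind_ys => u us lu.
        by apply: (lam_level_unique girth _ _ lk lu); lia.
      by move=> z; rewrite by'// by'// ltnW.
    + by apply/funext => z; rewrite un_ys//; ring.
have -> : (fun z : Om => (ys z p.+1 None i - ys z p None i) * G z) =
  (fun z : Om => \sum_(b | incident inc b i && (Some b != None))
     (yp z p.+1 b i - yp z p b i) * G z).
  by apply/funext => z; rewrite ysB mulr_suml.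
rewrite Ex_sum => [|b _]; last first.
  apply: nice_integ; apply: niceM => //; apply: niceB; apply: nice_yp => //.
  by rewrite ltnW.
apply: big1 => b /andP[bi bo]; apply: yp_orth => // j k ji lk.
by apply: bG; exists b, j.
Qed.

(** The derivative at [a] looks through the other entries of [a], the message quantities of [i] look
    away from [a]. These parts of the tree are disjoint, and the derivative has mean zero against
    anything blind to its part. *)
Lemma msg_node_orth s a kap : (s < L)%N -> let i := inc a kap in
  Ex mu (fun z : Om => yp z L.+1 a i * (am z s i a * um z s.+1 i a)) = 0.
Proof.
move=> sL i; apply: yp_mean0 => //.
- exact: incident_inc.
- by apply: niceM; [exact: nice_am|apply: nice_um; exact: ltnW].
move=> t j k tL ji lk.
have dis u : (u <= s)%N -> ~ lam u.+1 i (Some a) k.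
  move=> us; apply: (lam_disjoint_factor girth (incident_inc inc a j) (incident_inc inc a kap)
    _ _ lk); last by lia.
  exact/eqP.
by apply: blindM; [apply: blind_am => u us; apply: dis; exact: ltnW|exact: blind_um].
Qed.

End Orthogonality.

(** * Uniform moment bounds *)

Section BoundSequences.
Context {R : realType} {r : nat} (f : {ffun 'I_r -> bool} -> bool) (delta K : R).
Implicit Types B : nat -> R.

Definition fderB (k : 'I_r) B : nat -> R :=
  \big[@addB R/cstB 0]_(S : {set 'I_r} | k \in S)
    mulB (cstB (fhat f S)) (\big[@mulB R/cstB 1]_(j in (S :\ k)%SET) B).

(* The absolute values only make the bound independent of [k]. *)
Definition derB B : nat -> R := fun p => \sum_k `|fderB k B p|.

(* Moment bounds for the messages [w^l] and [z^l]. *)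
Fixpoint wzB l : (nat -> R) * (nat -> R) :=
  if l is l'.+1 then
    let: (w, z) := wzB l' in
    let w' := sumB (derB z) in (w', addB z (mulB (cstB K) (addB w' w)))
  else (cstB 0, gaussB delta).

Definition wB l := (wzB l).1.
Definition zB l := (wzB l).2.
Definition umB l := addB (wB l.+1) (wB l).
Definition ypB s := if s is s'.+1 then derB (zB s') else cstB 0.

(** One level of the gap, scaled by [sqrt d]. [C1 p.*2] is (P1) at exponent [2p]; [cstB 1] bounds
    [sqrt (d - 1) - sqrt d]; the two [ypB] belong to the factor that the message omits. *)
Definition gapB (C1 : nat -> R) s :=
  addB (mulB (fun p => C1 p.*2) (umB s))
       (mulB (cstB K) (addB (mulB (cstB 1) (umB s)) (addB (ypB s.+1) (ypB s)))).

(** [prodB], [linB] and [remB] copy the recursions of the product, [prod_lin] and [prod_rem], and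
    depend only on the number of factors. In [remB], [cstB 1] stands for a step [e] with
    [|e| <= 1]. *)
Fixpoint prodB B n := if n is n'.+1 then mulB B (prodB B n') else cstB 1.
Fixpoint linB B D n :=
  if n is n'.+1 then addB (mulB D (prodB B n')) (mulB B (linB B D n')) else cstB 0.
Fixpoint remB B D n :=
  if n is n'.+1 then
    addB (mulB D (linB B D n')) (mulB (addB B (mulB (cstB 1) D)) (remB B D n'))
  else cstB 0.

Definition fextB B D : nat -> R :=
  \big[@addB R/cstB 0]_(S : {set 'I_r}) mulB (cstB (fhat f S)) (remB B D #|S|).

Lemma derB_ge0 B p : 0 <= derB B p. Proof. by apply: sumr_ge0 => k _. Qed.

Lemma wBS l : wB l.+1 = sumB (derB (zB l)).
Proof. by rewrite /wB /zB /=; case: (wzB l). Qed.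

Lemma zBS l : zB l.+1 = addB (zB l) (mulB (cstB K) (umB l)).
Proof. by rewrite /umB /wB /zB /=; case: (wzB l). Qed.

End BoundSequences.

(** * Exact second-order expansion of a multilinear polynomial *)

Section SecondOrderExpansion.
Context {R : realType} {r : nat} (f : {ffun 'I_r -> bool} -> bool).
Implicit Types (x D : 'I_r -> R) (e : R) (q : seq 'I_r).

Fixpoint prod_lin x D q : R :=
  if q is j :: q' then D j * \prod_(k <- q') x k + x j * prod_lin x D q' else 0.

(** The exact cofactor of [e ^+ 2], itself a polynomial in [e]: the expansion is an identity, and
    only moments of this cofactor need a bound. *)
Fixpoint prod_rem x D e q : R :=
  if q is j :: q' then D j * prod_lin x D q' + (x j + e * D j) * prod_rem x D e q' else 0.

Lemma prod_expand x D e q : \prod_(j <- q) (x j + e * D j) =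
  \prod_(j <- q) x j + e * prod_lin x D q + e ^+ 2 * prod_rem x D e q.
Proof.
elim: q => [|j q ih]; first by rewrite !big_nil /=; ring.
by rewrite !big_cons ih /=; ring.
Qed.

Lemma prod_linE x D q : uniq q ->
  prod_lin x D q = \sum_(k <- q) D k * \prod_(j <- q | j != k) x j.
Proof.
elim: q => [|j q ih] /=; first by rewrite big_nil.
move=> /andP[jq uq]; rewrite big_cons ih// big_cons eqxx /=; congr (_ * _ + _).
  rewrite big_seq [RHS]big_seq_cond; apply: eq_bigl => k.
  by case kq: (k \in q) => //=; apply/esym; apply: contraNneq jq => <-.
rewrite mulr_sumr big_seq [RHS]big_seq; apply: eq_bigr => k kq.
rewrite big_cons ifT; last by apply: contraNneq jq => ->.
by rewrite mulrCA.
Qed.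

Lemma fext_expand x D e : fext f (fun k => x k + e * D k) =
  fext f x + e * \sum_k D k * fder f k x +
  e ^+ 2 * \sum_(S : {set 'I_r}) fhat f S * prod_rem x D e (enum S).
Proof.
have -> : \sum_k D k * fder f k x = \sum_(S : {set 'I_r}) fhat f S * prod_lin x D (enum S).
  rewrite /fder; under eq_bigr do rewrite mulr_sumr.
  rewrite (exchange_big_dep predT)//=; apply: eq_bigr => S _.
  rewrite prod_linE ?enum_uniq// mulr_sumr big_enum/=.
  apply: eq_bigr => k kS; rewrite mulrCA; congr (_ * (_ * _)).
  rewrite big_enum_cond/=; apply: eq_bigl => j.
  by rewrite in_setD1 andbC.
rewrite /fext !mulr_sumr -!big_split/=; apply: eq_bigr => S _.
by rewrite -!big_enum prod_expand; ring.
Qed.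

Context d (T : measurableType d) (P : probability T R).
Variables (X D : 'I_r -> T -> R) (e : R) (BX BD : nat -> R).
Hypothesis mX : forall k, mom P BX (X k).
Hypothesis mD : forall k, mom P BD (D k).
Hypothesis e01 : `|e| <= 1.

Lemma mom_cst_le1 (c : R) : `|c| <= 1 -> mom P (cstB 1) (fun=> c).
Proof. by move=> c1; apply: mom_bdd => //. Qed.

Lemma mom_prodB q : mom P (prodB BX (size q)) (fun w => \prod_(k <- q) X k w).
Proof.
elim: q => [|j q ih] /=.
  by apply: (mom_ext _ (mom_cst P 1)) => w; rewrite big_nil.
by apply: (mom_ext _ (momM (mX j) ih)) => w; rewrite big_cons.
Qed.

Lemma mom_linB q : mom P (linB BX BD (size q)) (fun w => prod_lin (X^~ w) (D^~ w) q).
Proof.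
elim: q => [|j q ih] /=; first exact: mom_cst.
by apply: momD; apply: momM => //; exact: mom_prodB.
Qed.

Lemma mom_remB q : mom P (remB BX BD (size q)) (fun w => prod_rem (X^~ w) (D^~ w) e q).
Proof.
elim: q => [|j q ih] /=; first exact: mom_cst.
apply: momD; apply: momM => //; first exact: mom_linB.
by apply: momD => //; apply: momM => //; exact: mom_cst_le1.
Qed.

Lemma mom_fextB : mom P (fextB f BX BD)
  (fun w => \sum_(S : {set 'I_r}) fhat f S * prod_rem (X^~ w) (D^~ w) e (enum S)).
Proof.
apply: mom_sum => S _; apply: momM; first exact: mom_cst.
by rewrite cardE; exact: mom_remB.
Qed.

Lemma mom_fder k B : (forall j, mom P B (X j)) ->
  mom P (derB f B) (fun w => fder f k (X^~ w)).
Proof.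
move=> mB; apply: (mom_le (B1 := fderB f k B)).
  apply: mom_sum => S _; apply: momM; first exact: mom_cst.
  by apply: mom_prod.
move=> p; rewrite /derB (bigD1 k)//= (le_trans (ler_norm _))// lerDl.
by apply: sumr_ge0.
Qed.

End SecondOrderExpansion.

(** * Moments of the messages and of the scaled gap, uniform in the hypergraph *)

Section UniformMoments.
Context {R : realType} {r : nat} (f : {ffun 'I_r -> bool} -> bool)
  {V E : finType} (inc : E -> 'I_r -> V) (d : nat)
  (Fm Fn : forall l : nat, l.-tuple R -> R) (L : nat) (delta K : R) (C1 : nat -> R).
Hypothesis fhat1 : forall S : {set 'I_r}, #|S| = 1%N -> fhat (R:=R) f S = 0.
Hypothesis inc_inj : forall b, injective (inc b).
Hypothesis deg : forall i, #|[set a | incident inc a i]%SET| = d.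
Hypothesis d2 : (2 <= d)%N.
Hypothesis girth : fg_girth_ge inc (4 * L + 4).
Hypothesis mFm : forall l, (l < L)%N -> measurable_fun setT (@Fm l).
Hypothesis mFn : forall l, (l < L)%N -> measurable_fun setT (@Fn l).
Hypothesis Fm_bdd : forall l, (l < L)%N -> forall t, `|@Fm l t| <= K.
Hypothesis Fn_bdd : forall l, (l < L)%N -> forall t, `|@Fn l t| <= K.

Local Notation Om := (@cspace V R).
Variable mu : probability Om R.
Hypothesis flip_inv : flip_invariant mu.
Hypothesis mom_coord : forall i, mom mu (gaussB delta) (fun z : Om => z i).

Local Notation zm := (zm f inc d Fm).
Local Notation wm := (wm f inc d Fm).
Local Notation zp := (zp f inc d Fm).
Local Notation yp := (yp f inc d Fm).
Local Notation ys := (ys f inc d Fm).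
Local Notation um := (um f inc d Fm).
Local Notation am := (am f inc d Fm).
Local Notation un := (un f inc d Fm).
Local Notation an := (an f inc d Fm Fn).
Local Notation zn := (zn f inc d Fm Fn).
Local Notation lam := (lam inc).

Let nice_coord i : nice mu (fun z : Om => z i) := mom_nice (mom_coord i).

Lemma card_other_factors i a : incident inc a i ->
  #|[pred b | incident inc b i && (b != a)]| = d.-1.
Proof.
move=> ai; have := cardsD1 a [set b | incident inc b i]%SET.
rewrite inE ai deg => ->; rewrite add1n /=; apply: eq_card => b.
by rewrite !inE andbC.
Qed.

Lemma mom_yp s b i : incident inc b i ->
  (forall j, mom mu (zB f delta K s.-1) (fun z : Om => zm z s.-1 (inc b j) b)) ->
  mom mu (ypB f delta K s) (fun z : Om => yp z s b i).
Proof.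
move=> /(incidentP inc) [kap <-]; case: s => [|s] h.
  by apply: (mom_ext _ (mom_cst mu 0)) => z; rewrite yp0.
apply: (mom_ext (X := fun z : Om => fder f kap (fun j => zm z s (inc b j) b))).
  by move=> z; rewrite /yp Dfac_inc.
exact: (@mom_fder _ _ f _ _ mu (fun j (z : Om) => zm z s (inc b j) b) kap _ h).
Qed.

(** There are [d - 1] summands and [y = (d - 1)^(-1/2)], so [N * y ^+ 2 = 1]. Branches through
    different factors at [i] share no variable, hence each summand is orthogonal to powers of sums
    of the others. *)
Lemma mom_wmS s i a : (s < L)%N -> incident inc a i ->
  (forall b j, mom mu (zB f delta K s) (fun z : Om => zm z s (inc b j) b)) ->
  mom mu (wB f delta K s.+1) (fun z : Om => wm z s.+1 i a).
Proof.
move=> sL ai mz.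
pose q := [seq b <- index_enum E | incident inc b i && (b != a)].
have qP b : b \in q -> incident inc b i by rewrite mem_filter => /andP[/andP[]].
pose y : R := (Num.sqrt (d%:R - 1))^-1.
have d1 : (0 : R) < d%:R - 1 by rewrite subr_gt0 ltr1n.
apply: (mom_ext (X := fun z : Om => y * \sum_(b <- q) yp z s.+1 b i)).
  by move=> z; rewrite wm_ys// /ys big_filter.
rewrite wBS; apply: mom_normalized_sum.
- by rewrite invr_ge0 sqrtr_ge0.
- rewrite /q -sum1_size big_filter sum1_card card_other_factors// exprVn sqr_sqrtr ?(ltW d1)//.
  by rewrite -subn1 natrB ?(ltnW d2)// mulfV// gt_eqF.
- exact: derB_ge0.
- by rewrite filter_uniq// index_enum_uniq.
- by move=> b /qP bi; apply: (@mom_yp s.+1).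
move=> b t n bq tq bt.
apply: (yp_mean0 d fhat1 inc_inj girth mFm Fm_bdd flip_inv nice_coord) => //; first by lia.
- exact: qP.
- apply: niceX; apply: niceM; first exact: nice_cst.
  by apply: nice_sum => c _; apply: (nice_yp inc d fhat1 mFm Fm_bdd nice_coord) => //; lia.
move=> u j k us ji lk z; congr ((y * _) ^+ n); apply: eq_big_seq => c ct.
apply: blind_yp => // u' j' us' ji' lk'.
apply: (lam_disjoint_variable girth (qP b bq) (qP c (tq c ct)) _
  (incident_inc inc b j) (incident_inc inc c j') _ _ _ lk lk').
- by move=> bc; rewrite bc ct in bt.
- by apply/nesym/eqP.
- by apply/nesym/eqP.
- by lia.
Qed.

Lemma mom_am s i a : (s < L)%N -> mom mu (cstB K) (fun z : Om => am z s i a).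
Proof.
move=> sL; apply: mom_bdd => [|z]; last exact: Fm_bdd.
by apply: nice_meas; apply: (nice_am inc d fhat1 mFm Fm_bdd nice_coord).
Qed.

Lemma mom_an s i : (s < L)%N -> mom mu (cstB K) (fun z : Om => an z s i).
Proof.
move=> sL; apply: mom_bdd => [|z]; last exact: Fn_bdd.
by apply: (measurable_an inc d fhat1 mFm mFn Fm_bdd nice_coord).
Qed.

Lemma mom_msg l : (l <= L)%N -> forall i a, incident inc a i ->
  mom mu (wB f delta K l) (fun z : Om => wm z l i a) /\
  mom mu (zB f delta K l) (fun z : Om => zm z l i a).
Proof.
elim: l => [_ i a ai|l ih lL i a ai].
  split; first exact: mom_cst.
  by apply: (mom_ext _ (mom_coord i)) => z; rewrite /zm big_ord0 addr0.
have {}ih := ih (ltnW lL).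
have mw : mom mu (wB f delta K l.+1) (fun z : Om => wm z l.+1 i a).
  by apply: mom_wmS => // b j; apply: (ih _ _ (incident_inc inc b j)).2.
split=> //; have [mwl mzl] := ih i a ai.
rewrite zBS; apply: (mom_ext (X := fun z : Om => zm z l i a + am z l i a * um z l.+1 i a)).
  by move=> z; rewrite /zm big_ord_recr /= addrA.
apply: momD => //; apply: momM; first exact: mom_am.
exact: momB.
Qed.

Lemma mom_um s i a : (s < L)%N -> incident inc a i ->
  mom mu (umB f delta K s) (fun z : Om => um z s.+1 i a).
Proof.
move=> sL ai; apply: momB; first exact: (mom_msg _ ai).1.
by apply: (mom_msg _ ai).1; rewrite ltnW.
Qed.

Hypothesis P1 : forall l, (l < L)%N -> forall i a, incident inc a i -> forall m,
  Ex mu (fun z : Om => `|an z l i - am z l i a| ^+ m) <= C1 m * (Num.sqrt d%:R) ^- m.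

Let sd : R := Num.sqrt d%:R.

Let sd0 : 0 < sd.
Proof. by rewrite sqrtr_gt0 ltr0n; lia. Qed.

Lemma mom_scaled_A_gap s i a : (s < L)%N -> incident inc a i ->
  mom mu (fun p => C1 p.*2) (fun z : Om => sd * (an z s i - am z s i a)).
Proof.
move=> sL ai.
have nA : nice mu (fun z : Om => an z s i - am z s i a).
  by apply: niceB; [exists (cstB K); exact: mom_an|exists (cstB K); exact: mom_am].
have nS := niceM (nice_cst mu sd) nA.
split; first exact: nice_meas nS.
move=> p; split; first exact: nice_integ (niceX _ nS).
have -> : (fun z : Om => (sd * (an z s i - am z s i a)) ^+ p.*2) =
    (fun z : Om => sd ^+ p.*2 * `|an z s i - am z s i a| ^+ p.*2).
  apply/funext => z; rewrite exprMn; congr (_ * _).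
  by rewrite -normrX ger0_norm// expr_double_ge0.
have iA : integ mu (fun z : Om => `|an z s i - am z s i a| ^+ p.*2).
  rewrite (_ : (fun z : Om => _) = fun z : Om => (an z s i - am z s i a) ^+ p.*2).
    by apply: nice_integ; exact: niceX.
  by apply/funext => z; rewrite -normrX ger0_norm// expr_double_ge0.
rewrite ExZ// mulrC -ler_pdivlMr ?exprn_gt0//; exact: P1.
Qed.

(** The node sum has the extra factor [a], and the two normalizations differ. Scaled by [sqrt d],
    each discrepancy is of order one. *)
Lemma scaled_u_gap z s i a : incident inc a i ->
  sd * (un z s.+1 i - um z s.+1 i a) =
  (Num.sqrt (d%:R - 1) - sd) * um z s.+1 i a + (yp z s.+1 a i - yp z s a i).
Proof.
move=> ai.
have d1 : (0 : R) < d%:R - 1 by rewrite subr_gt0 ltr1n.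
have sd1 : Num.sqrt (d%:R - 1) != 0 :> R by rewrite gt_eqF// sqrtr_gt0.
have split q : ys z q None i = yp z q a i + ys z q (Some a) i.
  rewrite /ys (bigD1 a)/= ?ai//; congr (_ + _); apply: eq_bigl => b.
  by rewrite andbT.
rewrite un_ys// !split um_ys//.
set U := ys z s.+1 (Some a) i; set U' := ys z s (Some a) i.
rewrite -/sd; field.
by rewrite sd1 gt_eqF.
Qed.

Lemma sqrt_pred_gap : `|Num.sqrt (d%:R - 1) - sd| <= 1.
Proof.
have d1 : (0 : R) < d%:R - 1 by rewrite subr_gt0 ltr1n.
have le1 : Num.sqrt (d%:R - 1) <= sd.
  by rewrite /sd ler_sqrt ?ler0n// gerBl.
rewrite ler0_norm ?subr_le0// opprB lerBlDr.
rewrite -(@ler_sqr R) ?nnegrE ?addr_ge0 ?sqrtr_ge0//.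
rewrite /sd sqr_sqrtr ?ler0n// sqrrD sqr_sqrtr ?(ltW d1)//.
have := sqrtr_ge0 (d%:R - 1 : R); rewrite expr1n mul1r; lra.
Qed.

Lemma mom_gap a kap : let i := inc a kap in
  mom mu (\big[@addB R/cstB 0]_(s < L) gapB f delta K C1 s)
    (fun z : Om => sd * (zn z L i - zm z L i a)).
Proof.
move=> i; have ai : incident inc a i by exact: incident_inc.
(* [A u - A' u' = (A - A') u' + A (u - u')], with primes for messages: in this arrangement only the
   message increments need a uniform moment bound. *)
apply: (mom_ext (X := fun z : Om => \sum_(s < L)
   ((sd * (an z s i - am z s i a)) * um z s.+1 i a +
    an z s i * ((Num.sqrt (d%:R - 1) - sd) * um z s.+1 i a +
        (yp z s.+1 a i - yp z s a i))))).
  move=> z; rewrite /zn /zm opprD addrACA subrr add0r -sumrB mulr_sumr.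
  by apply: eq_bigr => s _; rewrite -scaled_u_gap//; ring.
apply: mom_sum => s _; have sL := ltn_ord s.
apply: momD; first by apply: momM; [exact: mom_scaled_A_gap|exact: mom_um].
apply: momM; first exact: mom_an.
apply: momD.
  by apply: momM; [apply: mom_cst_le1; exact: sqrt_pred_gap|exact: mom_um].
apply: momB; apply: mom_yp => // j.
- by apply: (mom_msg _ (incident_inc inc a j)).2; rewrite ltnW.
- by apply: (mom_msg _ (incident_inc inc a j)).2; lia.
Qed.

End UniformMoments.

(** * The expansion *)

Section Assembly.
Context {R : realType} {r : nat} (f : {ffun 'I_r -> bool} -> bool)
  {V E : finType} (inc : E -> 'I_r -> V) (d : nat)
  (Fm Fn : forall l : nat, l.-tuple R -> R) (L : nat) (delta K : R) (C1 : nat -> R).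
Hypothesis r0 : (0 < r)%N.
Hypothesis V0 : (0 < #|V|)%N.
Hypothesis fhat1 : forall S : {set 'I_r}, #|S| = 1%N -> fhat (R:=R) f S = 0.
Hypothesis inc_inj : forall b, injective (inc b).
Hypothesis deg : forall i, #|[set a | incident inc a i]%SET| = d.
Hypothesis d2 : (2 <= d)%N.
Hypothesis girth : fg_girth_ge inc (4 * L + 4).
Hypothesis mFm : forall l, (l < L)%N -> measurable_fun setT (@Fm l).
Hypothesis mFn : forall l, (l < L)%N -> measurable_fun setT (@Fn l).
Hypothesis Fm_bdd : forall l, (l < L)%N -> forall t, `|@Fm l t| <= K.
Hypothesis Fn_bdd : forall l, (l < L)%N -> forall t, `|@Fn l t| <= K.

Local Notation Om := (@cspace V R).
Variable mu : probability Om R.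
Hypothesis flip_inv : flip_invariant mu.
Hypothesis mom_coord : forall i, mom mu (gaussB delta) (fun z : Om => z i).

Local Notation zm := (zm f inc d Fm).
Local Notation zp := (zp f inc d Fm).
Local Notation yp := (yp f inc d Fm).
Local Notation ys := (ys f inc d Fm).
Local Notation um := (um f inc d Fm).
Local Notation am := (am f inc d Fm).
Local Notation un := (un f inc d Fm).
Local Notation an := (an f inc d Fm Fn).
Local Notation zn := (zn f inc d Fm Fn).

Hypothesis P1 : forall l, (l < L)%N -> forall i a, incident inc a i -> forall m,
  Ex mu (fun z : Om => `|an z l i - am z l i a| ^+ m) <= C1 m * (Num.sqrt d%:R) ^- m.

Let nice_coord i : nice mu (fun z : Om => z i) := mom_nice (mom_coord i).
Let sd : R := Num.sqrt d%:R.
Let sd0 : 0 < sd. Proof. by rewrite sqrtr_gt0 ltr0n; lia. Qed.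

Let nAn s i (sL : (s < L)%N) : nice mu (fun z : Om => an z s i) :=
  nice_an inc d fhat1 mFm mFn Fm_bdd Fn_bdd nice_coord i sL.
Let nUn s i (sL : (s <= L)%N) : nice mu (fun z : Om => un z s.+1 i) :=
  nice_un inc d fhat1 mFm Fm_bdd nice_coord i sL.
Let nAm s i a (sL : (s < L)%N) : nice mu (fun z : Om => am z s i a) :=
  nice_am inc d fhat1 mFm Fm_bdd nice_coord i a sL.
Let nUm s i a (sL : (s <= L)%N) : nice mu (fun z : Om => um z s.+1 i a) :=
  nice_um inc d fhat1 mFm Fm_bdd nice_coord i a sL.
Let nYp s b i (sL : (s <= L.+1)%N) : nice mu (fun z : Om => yp z s b i) :=
  nice_yp inc d fhat1 mFm Fm_bdd nice_coord b i sL.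
Let nYs s o i (sL : (s <= L.+1)%N) : nice mu (fun z : Om => ys z s o i) :=
  nice_ys inc d fhat1 mFm Fm_bdd nice_coord o i sL.

(** Double counting: injectivity of [inc a] makes each incident variable occur exactly once among
    the entries of [a]. *)
Lemma sum_incidences (F : E -> V -> R) :
  \sum_a \sum_kap F a (inc a kap) = \sum_i \sum_(a | incident inc a i) F a i.
Proof.
rewrite [RHS](exchange_big_dep predT)//=; apply: eq_bigr => a _.
rewrite (partition_big (inc a) (fun i => incident inc a i))/=; last first.
  by move=> k _; exact: incident_inc.
apply: eq_bigr => i /(incidentP inc)[k ki].
by rewrite (big_pred1 k) ?ki// => k'; rewrite -ki (inj_eq (@inc_inj a)).
Qed.

Lemma card_incidences : (#|E| * r)%N%:R = (#|V| * d)%N%:R :> R.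
Proof.
have := sum_incidences (fun _ _ => 1).
have -> : \sum_i \sum_(a | incident inc a i) (1 : R) = \sum_(i : V) d%:R.
  apply: eq_bigr => i _; rewrite sumr_const -(deg i); congr (_ *+ _).
  by apply: eq_card => a; rewrite !inE.
under eq_bigr do rewrite sumr_const card_ord.
by rewrite !sumr_const -!mulrnA mulnC [in RHS]mulnC.
Qed.

Lemma mean_fext_msg a :
  Ex mu (fun z : Om => fext f (fun k => zm z L (inc a k) a)) = fhat f finset.set0.
Proof.
have nP (S : {set 'I_r}) : nice mu (fun z : Om => \prod_(k in S) zm z L (inc a k) a).
  by apply: nice_prod => k _; apply: (nice_zp inc d fhat1 mFm Fm_bdd nice_coord (s := L.+1)).
rewrite /fext Ex_sum => [|S _]; last by apply: integZ; exact: nice_integ.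
rewrite (bigD1 (finset.set0 : {set 'I_r}))//= big1 => [|S S0].
  rewrite addr0 ExZ; last exact: nice_integ.
  rewrite (_ : (fun _ => _) = fun=> 1) ?Ex_cst ?mulr1//.
  by apply/funext => z; rewrite big_set0.
rewrite ExZ; last exact: nice_integ.
have := prod_zp_mean0 d fhat1 inc_inj girth mFm Fm_bdd flip_inv nice_coord a (q := enum S)
   (leqnn L.+1) (enum_uniq _).
rewrite -cardE card_gt0 S0 => /(_ isT) e.
rewrite (_ : (fun _ => _) = fun z : Om => \prod_(j <- enum S) zp z L.+1 (inc a j) a).
  by rewrite e mulr0.
by apply/funext => z; rewrite big_enum.
Qed.

Lemma mean_gap_yp a i : incident inc a i ->
  Ex mu (fun z : Om => (zn z L i - zm z L i a) * yp z L.+1 a i) =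
  \sum_(s < L) Ex mu (fun z : Om => an z s i * un z s.+1 i * yp z L.+1 a i).
Proof.
move=> /(incidentP inc)[kap ki].
have n1 (s : 'I_L) : nice mu (fun z : Om => an z s i * un z s.+1 i * yp z L.+1 a i).
  apply: niceM; last exact: nYp.
  by apply: niceM; [exact: nAn|apply: nUn; exact: ltnW].
have n2 (s : 'I_L) : nice mu (fun z : Om => yp z L.+1 a i * (am z s i a * um z s.+1 i a)).
  apply: niceM; first exact: nYp.
  by apply: niceM; [exact: nAm|apply: nUm; exact: ltnW].
rewrite (_ : (fun z : Om => _) = fun z : Om => \sum_(s < L)
    (an z s i * un z s.+1 i * yp z L.+1 a i - yp z L.+1 a i * (am z s i a * um z s.+1 i a))).
  rewrite Ex_sum => [|s _]; last by apply: integB; exact: nice_integ.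
  apply: eq_bigr => s _; rewrite ExB; [|exact: nice_integ|exact: nice_integ].
  have := msg_node_orth d fhat1 inc_inj girth mFm Fm_bdd flip_inv nice_coord a kap (ltn_ord s).
  by rewrite /= ki => ->; rewrite subr0.
apply/funext => z; rewrite /zn /zm opprD addrACA subrr add0r -sumrB mulr_suml.
by apply: eq_bigr => s _; ring.
Qed.

Lemma mean_node_ys s i : (s < L)%N ->
  Ex mu (fun z : Om => an z s i * un z s.+1 i * ys z L.+1 None i) =
  sd * Ex mu (fun z : Om => an z s i * un z s.+1 i ^+ 2).
Proof.
move=> sL.
have n1 (t : 'I_L.+1) : nice mu (fun z : Om =>
     an z s i * un z s.+1 i * (ys z t.+1 None i - ys z t None i)).
  apply: niceM; last by apply: niceB; apply: nYs => //; exact: ltnW.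
  by apply: niceM; [exact: nAn|apply: nUn; exact: ltnW].
(* Telescoping from [ys z 0 None i = 0]; [node_orth] then removes every level [t] other than [s]. *)
rewrite (_ : (fun z : Om => _) = fun z : Om => \sum_(t < L.+1)
    an z s i * un z s.+1 i * (ys z t.+1 None i - ys z t None i)); last first.
  apply/funext => z; rewrite -mulr_sumr; congr (_ * _).
  by rewrite -(big_mkord predT (fun t => ys z t.+1 None i - ys z t None i))
       telescope_sumr// ys0// subr0.
rewrite Ex_sum => [|t _]; last exact: nice_integ.
rewrite (bigD1 (Ordinal (ltnW sL : s < L.+1)%N))//= [X in _ + X]big1 => [|t ts].
  rewrite addr0 -ExZ; last first.
    apply: nice_integ; apply: niceM; first exact: nAn.
    by apply: niceX; apply: nUn; exact: ltnW.
  congr Ex; apply/funext => z.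
  have -> : ys z s.+1 None i - ys z s None i = sd * un z s.+1 i.
    by rewrite un_ys// mulrA mulfV ?mul1r// gt_eqF.
  by ring.
apply: (node_orth d fhat1 inc_inj girth mFm mFn Fm_bdd Fn_bdd flip_inv nice_coord) => //.
- by rewrite -ltnS.
- by move=> e; move: ts; rewrite -val_eqE /= e eqxx.
Qed.

Let totB := fextB f (zB f delta K L) (\big[@addB R/cstB 0]_(s < L) gapB f delta K C1 s).

Lemma mean_fext_node a : exists2 rho : R, `|rho| <= (1 + totB 1%N) / d%:R &
  Ex mu (fun z : Om => fext f (fun k => zn z L (inc a k))) =
  fhat f finset.set0 +
  \sum_k Ex mu (fun z : Om => (zn z L (inc a k) - zm z L (inc a k) a) * yp z L.+1 a (inc a k)) +
  rho.
Proof.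
pose X k (z : Om) := zm z L (inc a k) a.
(* Expansion in the direction [D], of bounded moments, with step [sd^-1]: the square of the step is
   the factor [1 / d] of the remainder. *)
pose D k (z : Om) := sd * (zn z L (inc a k) - zm z L (inc a k) a).
have mX k : mom mu (zB f delta K L) (X k).
  by apply: (mom_msg fhat1 inc_inj deg d2 girth mFm Fm_bdd flip_inv mom_coord (leqnn L)
    (incident_inc inc a k)).2.
have mD k : mom mu (\big[@addB R/cstB 0]_(s < L) gapB f delta K C1 s) (D k).
  exact: (mom_gap fhat1 inc_inj deg d2 girth mFm mFn Fm_bdd Fn_bdd flip_inv mom_coord P1).
have sd1 : 1 <= sd.
  by rewrite /sd -[leLHS]sqrtr1 ler_sqrt ?ler0n// ler1n; lia.
have e1 : `|sd^-1| <= 1 by rewrite ger0_norm ?invr_ge0 ?(ltW sd0)// invf_le1.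
have mRem := mom_fextB f mX mD e1.
set Rem := (fun w : Om => _) in mRem.
have nX k : nice mu (X k) := mom_nice (mX k).
have nD k : nice mu (D k) := mom_nice (mD k).
exists (d%:R^-1 * Ex mu Rem).
  rewrite normrM ger0_norm ?invr_ge0 ?ler0n// mulrC ler_wpM2r ?invr_ge0 ?ler0n//.
  exact: mom_Ex_le mRem.
have nfX : nice mu (fun z => fext f (fun k => X k z)).
  apply: nice_sum => S _; apply: niceM; first exact: nice_cst.
  by apply: nice_prod.
have nDY k : nice mu (fun z : Om =>
    (zn z L (inc a k) - zm z L (inc a k) a) * yp z L.+1 a (inc a k)).
  apply: niceM; last exact: nYp.
  rewrite (_ : (fun z : Om => _) = fun z => sd^-1 * D k z).
    by apply: niceM => //; exact: nice_cst.
  by apply/funext => z; rewrite /D mulrA mulVf ?mul1r// gt_eqF.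
have -> : (fun z : Om => fext f (fun k => zn z L (inc a k))) =
  (fun z : Om => (fext f (fun k => X k z) +
    \sum_k (zn z L (inc a k) - zm z L (inc a k) a) * yp z L.+1 a (inc a k)) +
    d%:R^-1 * Rem z).
  apply/funext => z.
  have -> : (fun k => zn z L (inc a k)) = (fun k => X k z + sd^-1 * D k z).
    apply/funext => k; rewrite /X /D mulrA mulVf ?mul1r ?gt_eqF//.
    by rewrite addrC subrK.
  rewrite fext_expand; congr (_ + _ + _).
  - rewrite mulr_sumr; apply: eq_bigr => k _; rewrite mulrA; congr (_ * _).
      by rewrite /D mulrA mulVf ?mul1r// gt_eqF.
    by rewrite /yp Dfac_inc.
  - by rewrite exprVn sqr_sqrtr ?ler0n.
rewrite ExD; first last.
- by apply: integZ; exact: mom_integ mRem.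
- by apply: integD; [exact: nice_integ|apply: integ_sum => k _; exact: nice_integ].
rewrite ExD; first last.
- by apply: integ_sum => k _; exact: nice_integ.
- exact: nice_integ.
rewrite ExZ; last exact: mom_integ mRem.
rewrite mean_fext_msg Ex_sum//= => k _; exact: nice_integ.
Qed.

Lemma sum_mean_gap :
  \sum_a \sum_k Ex mu (fun z : Om =>
     (zn z L (inc a k) - zm z L (inc a k) a) * yp z L.+1 a (inc a k)) =
  sd * \sum_(s < L) \sum_i Ex mu (fun z : Om => an z s i * un z s.+1 i ^+ 2).
Proof.
rewrite (sum_incidences (fun a i => Ex mu (fun z : Om =>
     (zn z L i - zm z L i a) * yp z L.+1 a i))).
rewrite exchange_big/= mulr_sumr; apply: eq_bigr => i _.
transitivity (\sum_(a | incident inc a i) \sum_(s < L)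
    Ex mu (fun z : Om => an z s i * un z s.+1 i * yp z L.+1 a i)).
  by apply: eq_bigr => a ai; exact: mean_gap_yp.
rewrite exchange_big/= mulr_sumr; apply: eq_bigr => s _.
rewrite -mean_node_ys// -Ex_sum; last first.
  move=> a _; apply: nice_integ; apply: niceM; last exact: nYp.
  by apply: niceM; [exact: nAn|apply: nUn; exact: ltnW].
congr Ex; apply/funext => z; rewrite -mulr_sumr; congr (_ * _).
by apply: eq_bigl => b; rewrite andbT.
Qed.

Lemma mean_objective_expansion :
  `| (d%:R / r%:R * #|V|%:R)^-1 *
       \sum_(a : E) Ex mu (fun z : Om => fext f (fun k => zn z L (inc a k)))
     - (fhat f finset.set0 + r%:R / sd *
        \sum_(s < L) (#|V|%:R^-1 * \sum_i Ex mu (fun z : Om => an z s i * un z s.+1 i ^+ 2))) |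
  <= (1 + totB 1%N) / d%:R.
Proof.
have rR : r%:R != 0 :> R by rewrite pnatr_eq0 -lt0n.
have VR : #|V|%:R != 0 :> R by rewrite pnatr_eq0 -lt0n.
have dR : d%:R != 0 :> R by rewrite pnatr_eq0; lia.
have sdR : sd != 0 by rewrite gt_eqF.
have dE : d%:R = sd * sd by rewrite -expr2 sqr_sqrtr.
have Eeq : d%:R / r%:R * #|V|%:R = #|E|%:R :> R.
  by have := card_incidences; rewrite !natrM => e; apply: (mulIf rR); rewrite e; field.
have ER : #|E|%:R != 0 :> R by rewrite -Eeq !mulf_neq0 ?invr_eq0.
have [rho rhob rhoE] : exists2 rho : E -> R, forall a, `|rho a| <= (1 + totB 1%N) / d%:R &
   forall a, Ex mu (fun z : Om => fext f (fun k => zn z L (inc a k))) =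
  fhat f finset.set0 +
  \sum_k Ex mu (fun z : Om => (zn z L (inc a k) - zm z L (inc a k) a) * yp z L.+1 a (inc a k)) +
  rho a.
  have [rho h] := choice (fun a => let: ex_intro2 x p q := mean_fext_node a in
     ex_intro (fun x => _ /\ _) x (conj p q)).
  by exists rho => a; have [] := h a.
rewrite (eq_bigr _ (fun a _ => rhoE a)) !big_split/= sum_mean_gap sumr_const.
set M := \sum_(s < L) \sum_i _.
have -> : \sum_(s < L) (#|V|%:R^-1 * \sum_i Ex mu (fun z : Om => an z s i * un z s.+1 i ^+ 2)) =
   #|V|%:R^-1 * M by rewrite mulr_sumr.
(* The main terms cancel because [#|E| = d * #|V| / r] and [d = sd * sd] give
   [sd / #|E| = r / (sd * #|V|)]. *)
have -> : (d%:R / r%:R * #|V|%:R)^-1 * (fhat f finset.set0 *+ #|E| + sd * M + \sum_a rho a) -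
   (fhat f finset.set0 + r%:R / sd * (#|V|%:R^-1 * M)) = #|E|%:R^-1 * \sum_a rho a.
  rewrite -[_ *+ #|E|]mulr_natr -Eeq dE; field.
  by rewrite rR VR sdR.
rewrite normrM ger0_norm ?invr_ge0 ?ler0n//.
rewrite mulrC ler_pdivrMr ?lt0r ?ER ?ler0n//.
apply: (le_trans (ler_norm_sum _ _ _)).
apply: (le_trans (ler_sum _ (fun a _ => rhob a))).
by rewrite sumr_const mulr_natr.
Qed.

End Assembly.

(** * The estimate on the given probability space *)

Theorem mainTheorem2 (R : realType) (r : nat) (f : {ffun 'I_r -> bool} -> bool)
  (delta K : R) (C1 : nat -> R) :
  (2 <= r)%N ->
  (forall S : {set 'I_r}, #|S| = 1%N -> fhat (R:=R) f S = 0) ->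
  0 < delta -> 0 < K ->
  exists (C : R) (d0 : nat),
  forall (d : nat) (V E : finType) (inc : E -> 'I_r -> V)
    (Fm Fn : forall l : nat, l.-tuple R -> R)
    (dT : measure_display) (T : measurableType dT) (P : probability T R)
    (Z : V -> T -> R),
    (d0 <= d)%N ->
    (0 < #|V|)%N ->
    index_regular inc d ->
    fg_girth_ge inc (4 * Lof delta + 4) ->
    (forall l, (l < Lof delta)%N ->
       measurable_fun setT (Fm l) /\ measurable_fun setT (Fn l) /\
       (forall t, `|Fm l t| <= K) /\ (forall t, `|Fn l t| <= K)) ->
    iid_normal P Z delta ->
    (* Property (P1), with the O_d constants C1 m *)
    (forall l, (l < Lof delta)%N -> forall (i : V) (a : E), incident inc a i ->
       forall m : nat,
       ('E_P[fun w =>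
          (`|A_node f inc d Fm Fn (fun j => Z j w) (Lof delta) l i
             - A_msg f inc d Fm (fun j => Z j w) (Lof delta) l i a| ^+ m)%R]
        <= (C1 m * (Num.sqrt d%:R) ^- m)%:E)%E) ->
    let L := Lof delta in
    let n := #|V|%:R in
    let alpha := d%:R / r%:R in
    `| (alpha * n)^-1 *
         \sum_(a : E) Ex P (fun w =>
            fext f (fun k => z_node f inc d Fm Fn (fun j => Z j w) L L (inc a k)))
       - (fhat f (finset.set0 : {set 'I_r}) + r%:R / Num.sqrt d%:R *
          \sum_(l < L) (n^-1 * \sum_(i : V) Ex P (fun w =>
             A_node f inc d Fm Fn (fun j => Z j w) L l i *
             u_node f inc d Fm (fun j => Z j w) L l.+1 i ^+ 2))) |
    <= C / d%:R.
Proof.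
move=> r2 fhat1 delta0 K0; set L := Lof delta.
(* The moment bound of the second-order remainder, fixed before [d] and the hypergraph. [2 <= d]
   makes [d - 1] positive in the message normalization. *)
exists (1 + fextB f (zB f delta K L) (\big[@addB R/cstB 0]_(s < L) gapB f delta K C1 s) 1%N), 2%N.
move=> d V E inc Fm Fn dT T P Z d2 V0 [inc_inj [deg _]] girth hF iidZ P1; cbv zeta; rewrite -/L.
pose mu := cspace_law iidZ.
have mFm l : (l < L)%N -> measurable_fun setT (@Fm l) by move=> /hF[].
have mFn l : (l < L)%N -> measurable_fun setT (@Fn l) by move=> /hF[_ []].
have Fm_bdd l : (l < L)%N -> forall t, `|@Fm l t| <= K by move=> /hF[_ [_ []]].
have Fn_bdd l : (l < L)%N -> forall t, `|@Fn l t| <= K by move=> /hF[_ [_ []]].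
have flip_inv : flip_invariant mu by exact: cspace_law_flip.
have mom_coord i : mom mu (gaussB delta) (fun z : @cspace V R => z i) by exact: cspace_law_mom.
have nice_coord i : nice mu (fun z : @cspace V R => z i) := mom_nice (mom_coord i).
have nAn s i (sL : (s < L)%N) := nice_an inc d fhat1 mFm mFn Fm_bdd Fn_bdd nice_coord i sL.
have nAm s i a (sL : (s < L)%N) := nice_am inc d fhat1 mFm Fm_bdd nice_coord i a sL.
have nUn s i (sL : (s <= L)%N) := nice_un inc d fhat1 mFm Fm_bdd nice_coord i sL.
(* (P1) is transported to the law of the initial field. It bounds an extended real, so the integral
   is finite and passing to [fine] loses nothing. *)
have P1' l : (l < L)%N -> forall i a, incident inc a i -> forall m,
   Ex mu (fun z : @cspace V R => `|an f inc d Fm Fn z l i - am f inc d Fm z l i a| ^+ m)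
     <= C1 m * (Num.sqrt d%:R) ^- m.
  move=> lL i a ai m; have := P1 l lL i a ai m; rewrite unlock.
  set G := (fun z : @cspace V R => _ ^+ m).
  have mG : measurable_fun setT G.
    apply: measurable_funX; apply: measurableT_comp => //.
    by apply: measurable_funB; apply: nice_meas; [exact: nAn|exact: nAm].
  have G0 z : 0 <= G z by rewrite exprn_ge0.
  have -> : (\int[P]_w ((`|A_node f inc d Fm Fn (fun j => Z j w) L l i
             - A_msg f inc d Fm (fun j => Z j w) L l i a| ^+ m)%R)%:E =
      \int[P]_w (G (cspace_map Z w))%:E)%E.
    by apply: eq_integral => w _; rewrite A_nodeE ?A_msgE ?(ltnW lL).
  rewrite (cspace_law_ge0 iidZ mG G0) => le.
  rewrite ExE /Rintegral -lee_fin fineK// ge0_fin_numE; last first.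
    by apply: integral_ge0 => z _; rewrite lee_fin.
  by apply: le_lt_trans le _; rewrite ltry.
have main := mean_objective_expansion (ltnW r2) V0 fhat1 inc_inj deg d2 girth mFm mFn
  Fm_bdd Fn_bdd flip_inv mom_coord P1'.
apply: le_trans main; rewrite le_eqVlt; apply/orP; left; apply/eqP.
congr (`| _ * _ - (_ + _ * _) |).
- apply: eq_bigr => a _.
  rewrite -(@cspace_law_Ex V R dT T P Z delta iidZ).
    congr Ex; apply/funext => w; congr fext; apply/funext => k.
    by rewrite z_nodeE.
  apply: nice_integ; apply: nice_sum => S _; apply: niceM; first exact: nice_cst.
  apply: nice_prod => k _; apply: niceD => //; apply: nice_sum => s _.
  by apply: niceM; [exact: nAn|apply: nUn; exact: ltnW].
- apply: eq_bigr => s _; congr (_ * _); apply: eq_bigr => i _.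
  rewrite -(@cspace_law_Ex V R dT T P Z delta iidZ).
    congr Ex; apply/funext => w.
    by rewrite A_nodeE ?u_nodeE// ltnW.
  apply: nice_integ; apply: niceM; first exact: nAn.
  by apply: niceX; apply: nUn; exact: ltnW.
Qed.
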